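(* Let $d\in\mathbb N$, let $I$ be an index set and let $(\mathcal R,+,\cdot)$ be a ring. The linear operator $\Delta:\operatorname{span}_{\mathcal R}(\mathcal F_{0,d}[I])\to\operatorname{span}_{\mathcal R}(\mathcal F_{0,d}\tilde\times\mathcal F_{0,d}[I])$ determined by $\Delta[\mathbf 1]=(\mathbf 1,\mathbf 1)$ and $\Delta[T]=\sum_{c\in C(T)}(T_c^P,T_c^R)$ for non-empty $T$ satisfies: (a) for all $T\in\mathcal F_{0,d}[0]$: $\Delta\big[\lfloor T\rfloor\big]=(\lfloor T\rfloor,\mathbf 1)+\big(\mathrm{id}\,\tilde\otimes\lfloor\cdot\rfloor\big)\circ\Delta[T]$; (b) for all $(T,\iota)\in\mathcal F_{0,d}[0]\times I$: $\Delta\big[\mathcal E_\iota[T]\big]=(\mathcal E_\iota\,\tilde\otimes\,\mathcal E_\iota)\big[\Delta[T]\big]$; (c) for all $T,T'\in\mathcal F_{0,d}[I]$: $\Delta[T\circledast T']=(\circledast\,\tilde\otimes\,\circledast)\circ\overline{\mathrm{Twist}}\circ(\Delta\otimes\Delta)[T\otimes T']$. Further, this is the unique linear operator from $\operatorname{span}_{\mathcal R}(\mathcal F_{0,d}[I])$ to $\operatorname{span}_{\mathcal R}(\mathcal F_{0,d}\tilde\times\mathcal F_{0,d}[I])$ that satisfies (a), (b) and (c).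
   Context: Directed forests. A directed forest $(\mathcal N,E)$ is a finite acyclic directed graph each of whose components is a tree with all edges pointing towards its root (each non-root $x$ has exactly one parent $y$, $(x,y)\in E$). Depth means the number of edges to the root; $x<y$ means depth$(x)<$ depth$(y)$, and $x\lesseqqgtr y$ means equal depths. Lions forests. For an index set $J$, $\mathcal F_{0,d}[J]$ is the set of tuples $T=(\mathcal N,E,h_J,H,\mathcal L)$, up to isomorphism, where $(\mathcal N,E)$ is a directed forest, $\mathcal L:\mathcal N\to\{1,\dots,d\}$, $h_J=(h_\iota)_{\iota\in J}$ are mutually disjoint, possibly empty subsets of $\mathcal N$, $H$ is a partition of $\mathcal N\setminus\bigcup_\iota h_\iota$ into non-empty blocks, and, with $H'=(H\cup\{h_\iota\}_{\iota\in J})\setminus\{\emptyset\}$: (1) $h\in H'$, $x,y\in h$, $x<y$ imply there is $z\in h$ with $(y,z)\in E$; (2) $h\in H'$, $x_1,y_1\in h$, $x_1\lesseqqgtr y_1$, $(x_1,x_2),(y_1,y_2)\in E$, $x_2\neq y_2$ imply $x_2,y_2\in h$; (3) each non-empty $h_\iota$ contains a root. The empty forest $\mathbf 1$ is included. $[0]$ abbreviates $[\{0\}]$. The product $\circledast$ on $\mathcal F_{0,d}[J]$ takes disjoint unions of nodes, edges and labels, $h_\iota=h^1_\iota\cup h^2_\iota$ and $H=H^1\cup H^2$. Coupled pairs. For $Y\in\mathcal F_{0,d}[I]$ with set of hyperedges $H^Y$ put $\mathcal F_{0,d}[Y]=\mathcal F_{0,d}[I\cup H^Y]$ (the hyperedges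 of $Y$ serve as extra tags). $\mathcal F_{0,d}\tilde\times\mathcal F_{0,d}[I]$ is the set of pairs $(\Upsilon,Y)$ with $Y\in\mathcal F_{0,d}[I]$ and $\Upsilon\in\mathcal F_{0,d}[Y]$. $\operatorname{span}_{\mathcal R}(S)$ is the free $\mathcal R$-module on a set $S$. Cuts. An admissible cut of a non-empty tree is a non-empty $c\subseteq E$ such that the path from any node to the root contains at most one edge of $c$, or one of two formal empty cuts $(\emptyset,+),(\emptyset,-)$. For a non-empty $c$, $\mathcal N_c^R$ is the set of nodes whose path to the root contains no edge of $c$; $\mathcal N^R_{(\emptyset,+)}=\mathcal N$ and $\mathcal N^R_{(\emptyset,-)}=\emptyset$. For a non-empty forest, $C(T)$ is the product of the sets of admissible cuts of its component trees and $\mathcal N_c^R$ is the union over the components. Put $\mathcal N_c^P=\mathcal N\setminus\mathcal N_c^R$. The root $T_c^R\in\mathcal F_{0,d}[I]$ has nodes $\mathcal N_c^R$, the edges and labels restricted to $\mathcal N_c^R$, tagged hyperedges $h_\iota\cap\mathcal N_c^R$ and hyperedges $H_c^R=\{h\cap\mathcal N_c^R:h\in H\}\setminus\{\emptyset\}$. The prune $T_c^P\in\mathcal F_{0,d}[I\cup H_c^R]$ has nodes $\mathcal N_c^P$, the restricted edges and labels, tagged hyperedges $h_\iota\cap\mathcal N_c^P$ for $\iota\in I$ and $h\cap\mathcal N_c^P$ for the tag $h\cap\mathcal N_c^R\in H_c^R$ ($h\in H$), and hyperedges $H_c^P=\{h\cap\mathcal N_c^P:h\in H,\ h\cap\mathcal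 N_c^R=\emptyset\}\setminus\{\emptyset\}$. The operator $\Delta$ is defined in this way for every index set, and the index set is suppressed from the notation: applied to an element of $\mathcal F_{0,d}[0]$ in (a) and (b), $\Delta[T]$ and $\Delta[\lfloor T\rfloor]$ are taken for the index set $\{0\}$. Operators. Rooting, for $T\in\mathcal F_{0,d}[0]$ and a label $i\in\{1,\dots,d\}$: $\lfloor T\rfloor_i$ adds a new node $x_0$ with label $i$, adds edges from all roots of $T$ to $x_0$, and replaces $h_0$ by $h_0\cup\{x_0\}$; $\lfloor\cdot\rfloor$ stands for $\lfloor\cdot\rfloor_i$ with the label $i$ suppressed (the same $i$ throughout (a)). For $\iota\in I$, $\mathcal E_\iota:\mathcal F_{0,d}[0]\to\mathcal F_{0,d}[I]$ makes $h_0$ the hyperedge tagged $\iota$, makes all other tagged hyperedges empty and leaves $H$ unchanged. The coupled tensor product $\tilde\otimes$ of operators acts componentwise on coupled pairs: $(\mathrm{id}\,\tilde\otimes\lfloor\cdot\rfloor)(\Upsilon,Y)=(\Upsilon,\lfloor Y\rfloor)$ (rooting leaves $H^Y$ unchanged), and $(\mathcal E_\iota\tilde\otimes\mathcal E_\iota)(\Upsilon,Y)=(\Upsilon',\mathcal E_\iota[Y])$ where $\Upsilon'$ is $\Upsilon$ with tag $0$ renamed $\iota$, the tags in $H^Y$ unchanged and the tags in $I\setminus\{\iota\}$ empty. $\overline{\mathrm{Twist}}$ sends $\big((\Upsilon_1,Y_1),(\Upsilon_2,Y_2)\big)$ to $\big((\Upsilon_1,\Upsilon_2),(Y_1,Y_2)\big)$,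 where each $\Upsilon_j$ is viewed in $\mathcal F_{0,d}[I\cup H^{Y_1}\cup H^{Y_2}]$ by leaving the additional tags empty, and $(\circledast\tilde\otimes\circledast)\big((\Upsilon_1,\Upsilon_2),(Y_1,Y_2)\big)=(\Upsilon_1\circledast\Upsilon_2,Y_1\circledast Y_2)$, using $H^{Y_1\circledast Y_2}=H^{Y_1}\cup H^{Y_2}$. All operators are extended linearly; $\Delta\otimes\Delta$ takes values in $\operatorname{span}_{\mathcal R}$ of the set of pairs of coupled pairs, with coefficients multiplied.
   Formalization: Uniqueness is stated only for non-empty I: for empty I, (b) is vacuous, (a) does not involve the operator on span(F[I]), and the zero operator satisfies (c). In (a) and (b), Δ for index set {0} is the given cut operator. *)

(* Defs.v *)
From HB Require Import structures.
From mathcomp Require Import all_boot all_algebra.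
From mathcomp Require Import boolp.
From mathcomp Require Import finmap monalg.

Set Implicit Arguments.
Unset Strict Implicit.
Unset Printing Implicit Defensive.

Import GRing.Theory.

Local Open Scope ring_scope.
Local Open Scope quotient_scope.

Section DirectedForest.
Variables (N : finType) (E : {set N * N}).

Definition edge : rel N := fun x y => (x, y) \in E.

Definition is_root (x : N) : bool := [forall y, ~~ edge x y].

(* An edge (x, y) points from x to its parent y. In a finite acyclic graph in
   which every non-root has exactly one parent, each component is a tree with
   all edges pointing towards its root. *)
Definition directed_forest : Prop :=
  (forall x y, edge x y -> ~~ connect edge y x) /\
  (forall x y z, edge x y -> edge x z -> y = z).

(* The edges on the path from x to its root: in a directed forest these are
   the edges that leave a node that is reachable from x. *)
Definition root_path (x : N) : {set N * N} :=
  [set e in E | connect edge x e.1].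

Definition depth (x : N) : nat := #|root_path x|.

End DirectedForest.

(* h is the family of tagged hyperedges, H the set of untagged ones. *)
Definition nonempty_hyperedge (J : Type) (N : finType) (h : J -> {set N})
    (H : {set {set N}}) (s : {set N}) : Prop :=
  s != set0 /\ (s \in H \/ exists j, s = h j).

Record lions_conditions (J : Type) (N : finType) (E : {set N * N})
    (h : J -> {set N}) (H : {set {set N}}) : Prop := LionsConditions {
  lions_forest : directed_forest E;
  lions_disjoint : forall j k, j <> k -> [disjoint h j & h k];
  lions_partition : partition H [set x | ~~ `[< exists j, x \in h j >]];
  lions_climb : forall s, nonempty_hyperedge h H s ->
    forall x y, x \in s -> y \in s -> (depth E x < depth E y)%N ->
    exists2 z, z \in s & (y, z) \in E;
  lions_parents : forall s, nonempty_hyperedge h H s ->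
    forall x1 y1 x2 y2, x1 \in s -> y1 \in s -> depth E x1 = depth E y1 ->
    (x1, x2) \in E -> (y1, y2) \in E -> x2 <> y2 -> x2 \in s /\ y2 \in s;
  lions_tag_root : forall j, h j != set0 ->
    exists2 x, x \in h j & is_root E x
}.

Section DepthTheory.
Variables (N : finType) (E : {set N * N}).
Hypothesis fE : directed_forest E.

Lemma root_path_root x : is_root E x -> root_path E x = set0.
Proof.
move=> rx; apply/setP=> -[u v]; rewrite !inE /=; apply/negP=> /andP[uv xu].
case/connectP: xu => -[|a p] /= => [_ eux|/andP[xa _] _].
  by move/forallP: rx => /(_ v); rewrite -eux /edge uv.
by move/forallP: rx => /(_ a); rewrite xa.
Qed.

Lemma root_path_edge x y : edge E x y ->
  root_path E x = (x, y) |: root_path E y.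
Proof.
move=> xy; apply/setP=> -[u v]; rewrite !inE /= xpair_eqE.
apply/andP/orP => [[uv xu]|[/andP[/eqP-> /eqP->]|/andP[uv yu]]]; last 2 first.
- by split; [exact: xy | exact: connect0].
- by split=> //; apply: connect_trans yu; apply: connect1.
case/connectP: xu => -[|a p] /= => [_ eux|/andP[xa pp] eu].
  by left; rewrite eux eqxx /= (fE.2 x v y) // -eux.
right; rewrite uv /=; apply/connectP; exists p => //.
all: by rewrite (fE.2 x y a).
Qed.

Lemma depth_root x : is_root E x -> depth E x = 0%N.
Proof. by move=> rx; rewrite /depth root_path_root // cards0. Qed.

Lemma depth_edge x y : edge E x y -> depth E x = (depth E y).+1.
Proof.
move=> xy; rewrite /depth (root_path_edge xy) cardsU1 inE /=.
by rewrite (negbTE (fE.1 _ _ xy)) andbF.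
Qed.

Lemma rootPn x : ~~ is_root E x -> exists y, edge E x y.
Proof. by case/forallPn=> y /negPn xy; exists y. Qed.

Lemma depth_gt0 x : (0 < depth E x)%N -> exists y, edge E x y.
Proof.
by move=> dx; apply/rootPn/negP=> /depth_root dx0; rewrite dx0 in dx.
Qed.

Lemma depth_le_connect x y : connect (edge E) x y -> (depth E y <= depth E x)%N.
Proof.
case/connectP=> p; elim: p x => [|a p IHp] x /= => [_ -> //|/andP[xa pp] eq].
by rewrite (depth_edge xa) leqW // IHp.
Qed.

Lemma connect_depth_eq x y :
  connect (edge E) x y -> depth E x = depth E y -> x = y.
Proof.
case/connectP=> -[|a p] /= => [_ -> //|/andP[xa pp] eq].
have : connect (edge E) a y by apply/connectP; exists p.
by move/depth_le_connect; rewrite (depth_edge xa) => + e; rewrite -e ltnn.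
Qed.

End DepthTheory.

Lemma depth_map (M N : finType) (E' : {set M * M}) (E : {set N * N})
    (f : M -> N) (k : nat) :
    directed_forest E' -> directed_forest E ->
    (forall x y, edge E' x y -> edge E (f x) (f y)) ->
    (forall x, is_root E' x -> depth E (f x) = k) ->
  forall x, depth E (f x) = (depth E' x + k)%N.
Proof.
move=> fE' fE fedge froot x; have [n] := ubnP (depth E' x).
elim: n x => // n IHn x lt_xn; case: (boolP (is_root E' x)) => [rx|].
  by rewrite froot // (depth_root rx).
case/rootPn=> y xy; rewrite (depth_edge fE (fedge _ _ xy)).
move: lt_xn; rewrite (depth_edge fE' xy) addSn => lt_xn; rewrite IHn //.
Qed.

Section ConditionsTheory.
Variables (J : Type) (N : finType) (E : {set N * N}).
Variables (h : J -> {set N}) (H : {set {set N}}).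

(* A pointwise form of the conditions that is convenient to construct and to
   use. *)
Lemma lions_conditions_intro :
    directed_forest E ->
    (forall j k x, x \in h j -> x \in h k -> j = k) ->
    set0 \notin H ->
    (forall s t x, s \in H -> t \in H -> x \in s -> x \in t -> s = t) ->
    (forall s j x, s \in H -> x \in s -> x \in h j -> False) ->
    (forall x, (exists j, x \in h j) \/ (exists2 s, s \in H & x \in s)) ->
    (forall s, nonempty_hyperedge h H s ->
      forall x y, x \in s -> y \in s -> (depth E x < depth E y)%N ->
      exists2 z, z \in s & (y, z) \in E) ->
    (forall s, nonempty_hyperedge h H s ->
      forall x1 y1 x2 y2, x1 \in s -> y1 \in s -> depth E x1 = depth E y1 ->
      (x1, x2) \in E -> (y1, y2) \in E -> x2 <> y2 -> x2 \in s /\ y2 \in s) ->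
    (forall j x, x \in h j -> exists2 y, y \in h j & is_root E y) ->
  lions_conditions E h H.
Proof.
move=> fE hdis H0 Hdis Hh cov c1 c2 c3; split=> //.
- move=> j k njk; rewrite -setI_eq0; apply/eqP/setP=> x; rewrite !inE.
  by apply/negP=> /andP[xj xk]; apply: njk; apply: hdis xj xk.
- apply/and3P; split=> //.
    apply/eqP/setP=> x; rewrite inE; apply/bigcupP/idP => [[s sH xs]|].
      by apply/asboolPn=> -[j xj]; apply: Hh sH xs xj.
    by move/asboolPn=> nx; case: (cov x) => // -[s sH xs]; exists s.
  apply/trivIsetP=> s t sH tH nst; rewrite -setI_eq0.
  apply/eqP/setP=> x; rewrite !inE; apply/negP=> /andP[xs xt].
  by case/eqP: nst; apply: Hdis xs xt.
- by move=> j /set0Pn[x xj]; apply: c3 xj.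
Qed.

Hypothesis LC : lions_conditions E h H.

Lemma lions_tag_inj j k x : x \in h j -> x \in h k -> j = k.
Proof.
move=> xj xk; apply: contrapT => /(lions_disjoint LC).
by move/disjointFr => /(_ _ xj); rewrite xk.
Qed.

Lemma lions_set0 : set0 \notin H.
Proof. by case/and3P: (lions_partition LC). Qed.

Lemma lions_block_inj s t x :
  s \in H -> t \in H -> x \in s -> x \in t -> s = t.
Proof.
case/and3P: (lions_partition LC) => _ /trivIsetP dis _ sH tH xs xt.
apply: contraTeq xt => nst; move: (dis _ _ sH tH nst).
by move/disjointFr => ->.
Qed.

Lemma lions_block_tag s j x : s \in H -> x \in s -> x \in h j -> False.
Proof.
case/and3P: (lions_partition LC) => /eqP cov _ _ sH xs xj.
have : x \in cover H by apply/bigcupP; exists s.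
by rewrite cov inE => /asboolPn; apply; exists j.
Qed.

Lemma lions_cover x : (exists j, x \in h j) \/ (exists2 s, s \in H & x \in s).
Proof.
case: (pselect (exists j, x \in h j)) => [|nx]; [by left | right].
case/and3P: (lions_partition LC) => /eqP cov _ _.
have : x \in cover H by rewrite cov inE; apply/asboolPn.
by case/bigcupP=> s sH xs; exists s.
Qed.

Lemma nonempty_tag j x : x \in h j -> nonempty_hyperedge h H (h j).
Proof. by move=> xj; split; [apply/set0Pn; exists x | right; exists j]. Qed.

Lemma nonempty_block s : s \in H -> nonempty_hyperedge h H s.
Proof.
by move=> sH; split; [apply: contraNneq lions_set0 => <- | left].
Qed.

Lemma lions_tag_up j x y : x \in h j -> edge E x y -> y \in h j.
Proof.
move=> xj xy; have ne := nonempty_tag xj.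
have [r rj rr] := lions_tag_root LC ne.1.
have [|z zj xz] := lions_climb LC ne rj xj.
  by rewrite (depth_root rr) (depth_edge (lions_forest LC) xy).
by rewrite ((lions_forest LC).2 x y z).
Qed.

Lemma lions_tag_up_root j x : x \in h j ->
  exists r, [/\ r \in h j, connect (edge E) x r & is_root E r].
Proof.
have [n] := ubnP (depth E x); elim: n x => // n IHn x lt_xn xj.
case: (boolP (is_root E x)) => [rx|]; first by exists x; rewrite connect0.
case/rootPn=> y xy; have [||r [rj yr rr]] := IHn y.
- by move: lt_xn; rewrite (depth_edge (lions_forest LC) xy) ltnS.
- exact: lions_tag_up xj xy.
by exists r; split=> //; apply: connect_trans yr; apply: connect1.
Qed.

(* An ancestor of x at the depth of y that is still in the hyperedge. *)
Lemma lions_ancestor s x y : nonempty_hyperedge h H s ->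
    x \in s -> y \in s -> (depth E y <= depth E x)%N ->
  exists z, [/\ z \in s, connect (edge E) x z & depth E z = depth E y].
Proof.
move=> ns; have [n] := ubnP (depth E x).
elim: n x => // n IHn x lt_xn xs ys; rewrite leq_eqVlt => /orP[/eqP e|lt_yx].
  by exists x; split=> //; apply: connect0.
have [z zs xz] := lions_climb LC ns ys xs lt_yx.
have dx := depth_edge (lions_forest LC) xz.
have [||w [ws zw dw]] := IHn z _ zs ys; [by rewrite -dx| by rewrite -ltnS -dx|].
by exists w; split=> //; apply: connect_trans zw; apply: connect1.
Qed.

End ConditionsTheory.

Section Restriction.
Variables (J : Type) (N : finType) (E : {set N * N}).
Variables (h : J -> {set N}) (H : {set {set N}}).
Hypothesis LC : lions_conditions E h H.

Variable A : {set N}.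
Hypothesis upA : forall x y, x \in A -> edge E x y -> y \in A.

Lemma up_connect x y : x \in A -> connect (edge E) x y -> y \in A.
Proof.
move=> + /connectP[p]; elim: p x => [|a p IHp] x /= xA; first by move=> _ ->.
by case/andP=> xa; apply: IHp; apply: upA xa.
Qed.

Definition restrE (M : finType) (f : M -> N) : {set M * M} :=
  [set e | edge E (f e.1) (f e.2)].

Definition restrH (M : finType) (f : M -> N) : {set {set M}} :=
  [set f @^-1: s | s : {set N} in H] :\ set0.

Lemma restr_forest (M : finType) (f : M -> N) : injective f ->
  directed_forest (restrE f).
Proof.
move=> f_inj; split=> [x y xy|x y z].
  rewrite /edge inE /= in xy; apply: contra ((lions_forest LC).1 _ _ xy).
  case/connectP=> p pp ->; apply/connectP; exists (map f p).
    rewrite path_map; apply: sub_path pp => u v; by rewrite /edge inE.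
  by rewrite last_map.
by rewrite /edge !inE /= => xy xz; apply/f_inj/((lions_forest LC).2 (f x)).
Qed.

Section Top.
Variables (M : finType) (f : M -> N).
Hypotheses (f_inj : injective f) (imf : forall y, y \in A <-> exists m, y = f m).

Let fA m : f m \in A. Proof. by apply/imf; exists m. Qed.

Lemma top_root m : is_root (restrE f) m = is_root E (f m).
Proof.
apply/forallP/forallP => nr y; apply/negP.
  move=> my; have /imf[m' ey] := upA (fA m) my; subst y.
  by move/negP: (nr m'); rewrite /edge inE.
by rewrite /edge inE /=; apply/negP.
Qed.

Lemma top_depth m : depth E (f m) = depth (restrE f) m.
Proof.
rewrite (@depth_map _ _ (restrE f) E f 0) ?addn0 //.
- exact: restr_forest.
- exact: lions_forest LC.
- by move=> x y; rewrite /edge inE.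
by move=> x; rewrite top_root => /depth_root.
Qed.

Lemma top_nonempty s : nonempty_hyperedge (fun j => f @^-1: h j) (restrH f) s ->
  exists2 t, nonempty_hyperedge h H t & s = f @^-1: t.
Proof.
case=> s0 [|[j es]].
  rewrite !inE s0 /= => /imsetP[t tH es]; exists t => //.
  exact: nonempty_block LC _ tH.
exists (h j) => //; case/set0Pn: s0 => x; rewrite es inE.
exact: nonempty_tag.
Qed.

Lemma top_conditions :
  lions_conditions (restrE f) (fun j => f @^-1: h j) (restrH f).
Proof.
apply: lions_conditions_intro.
- exact: restr_forest.
- by move=> j k x; rewrite !inE; apply: lions_tag_inj LC _ _ _.
- by rewrite !inE eqxx.
- move=> s t x; rewrite !inE => /andP[_ /imsetP[s' s'H ->]].
  case/andP=> _ /imsetP[t' t'H ->]; rewrite !inE => xs xt.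
  by rewrite (lions_block_inj LC s'H t'H xs xt).
- move=> s j x; rewrite !inE => /andP[_ /imsetP[s' s'H ->]]; rewrite !inE.
  exact: lions_block_tag LC _ _ _ s'H.
- move=> x; case: (lions_cover LC (f x)) => [[j xj]|[s sH xs]].
    by left; exists j; rewrite inE.
  right; exists (f @^-1: s); last by rewrite inE.
  rewrite !inE imset_f // andbT; apply/set0Pn; exists x; by rewrite inE.
- move=> _ /top_nonempty[s ns ->] x y; rewrite !inE -!top_depth => xs ys lt.
  have [z zs yz] := lions_climb LC ns xs ys lt.
  have /imf[m ez] := upA (fA y) yz; subst z.
  by exists m; rewrite inE.
- move=> _ /top_nonempty[s ns ->] x1 y1 x2 y2; rewrite !inE -!top_depth.
  move=> xs ys e xx yy ne; apply: (lions_parents LC ns xs ys e xx yy).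
  by move/f_inj.
move=> j x; rewrite inE => xj.
have [r [rj xr rr]] := lions_tag_up_root LC xj.
have /imf[m em] := up_connect (fA x) xr.
by exists m; rewrite ?inE -?em // top_root -em.
Qed.

End Top.

Section Bottom.
Variables (M : finType) (g : M -> N).
Hypotheses (g_inj : injective g) (img : forall y, y \in A <-> exists m, y = g m).
Variables (L : finType) (f : L -> N).
Hypothesis f_inj : injective f.
Hypothesis imf : forall y, y \notin A <-> exists m, y = f m.

Let gA m : g m \in A. Proof. by apply/img; exists m. Qed.
Let fA m : f m \notin A. Proof. by apply/imf; exists m. Qed.

Definition pruneh (j : J + {k | k \in restrH g}) : {set L} :=
  match j with
  | inl j => f @^-1: h j
  | inr k => [set m | [exists s in H, (g @^-1: s == val k) && (f m \in s)]]
  end.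

Definition pruneH : {set {set L}} :=
  [set f @^-1: s | s : {set N} in H & g @^-1: s == set0] :\ set0.

Let fP : directed_forest (restrE f). Proof. exact: restr_forest. Qed.

Let edgeP x y : edge (restrE f) x y = edge E (f x) (f y).
Proof. by rewrite /edge inE. Qed.

Lemma down_edge y x : edge E x y -> y \notin A -> x \notin A.
Proof. by move=> xy; apply: contra => /upA; apply. Qed.

Lemma bottom_connect x y : connect (edge E) (f x) (f y) ->
  connect (edge (restrE f)) x y.
Proof.
case/connectP=> p; elim: p x => [|a p IHp] x /=.
  by move=> _ /f_inj->; apply: connect0.
case/andP=> xa pp eq; have /imf[b eb] : a \notin A.
  apply: contra (fA y) => aA; apply: up_connect aA _.
  by apply/connectP; exists p.
subst a; apply: connect_trans (IHp b pp eq).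
by apply: connect1; rewrite edgeP.
Qed.

Lemma prune_step s y m a : nonempty_hyperedge h H s ->
  f y \in s -> a \in s -> edge E (f y) (f m) ->
  (forall w, connect (edge E) a w -> w \in s -> edge E w (f m) -> False) ->
  f m \in s.
Proof.
move=> ns ys sa ym no; have dy := depth_edge (lions_forest LC) ym.
have [lt|le] := ltnP (depth E a) (depth E (f y)).
  have [z zs yz] := lions_climb LC ns sa ys lt.
  by rewrite ((lions_forest LC).2 (f y) (f m) z).
have [w [ws aw dw]] := lions_ancestor LC ns sa ys le.
have [p wp] : exists p, edge E w p.
  by apply: depth_gt0; rewrite dw dy.
have [ep|np] := pselect (p = f m).
  by case: (no w aw ws); rewrite -ep.
by case: (lions_parents LC ns ws ys dw wp ym np).
Qed.

Lemma prune_nonempty s : nonempty_hyperedge pruneh pruneH s ->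
  exists2 t, nonempty_hyperedge h H t & s = f @^-1: t.
Proof.
case=> s0 [|[[j|[k kH]] es]].
- rewrite !inE s0 /= => /imsetP[t]; rewrite inE => /andP[tH _] es.
  by exists t => //; apply: nonempty_block LC _ tH.
- exists (h j) => //; case/set0Pn: s0 => x; rewrite es inE.
  exact: nonempty_tag.
have := kH; rewrite !inE => /andP[k0 /imsetP[t tH ek]].
exists t; first exact: nonempty_block LC _ tH.
rewrite es; apply/setP=> x; rewrite !inE /=.
apply/existsP/idP => [[t' /and3P[t'H /eqP ek' xt']]|xt].
  have /set0Pn[m mk] := k0.
  rewrite (lions_block_inj LC (x := g m) tH t'H) //.
    by rewrite ek inE in mk.
  by rewrite -ek' inE in mk.
by exists t; rewrite tH ek eqxx.
Qed.

Lemma bottom_conditions : lions_conditions (restrE f) pruneh pruneH.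
Proof.
apply: lions_conditions_intro => //.
- move=> [j|k] [j'|k'] x; rewrite !inE.
  + by move=> xj xj'; rewrite (lions_tag_inj LC xj xj').
  + move=> xj /existsP[s /and3P[sH _ xs]].
    by case: (lions_block_tag LC sH xs xj).
  + move=> /existsP[s /and3P[sH _ xs]] xj.
    by case: (lions_block_tag LC sH xs xj).
  move=> /existsP[s /and3P[sH /eqP es xs]] /existsP[t /and3P[tH /eqP et xt]].
  by congr inr; apply: val_inj; rewrite -es -et (lions_block_inj LC sH tH xs xt).
- by rewrite !inE eqxx.
- move=> s t x; rewrite !inE => /andP[_ /imsetP[s' + ->]].
  rewrite inE => /andP[s'H _] /andP[_ /imsetP[t' + ->]].
  rewrite inE => /andP[t'H _]; rewrite !inE => xs xt.
  by rewrite (lions_block_inj LC s'H t'H xs xt).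
- move=> s [j|k] x; rewrite !inE => /andP[_ /imsetP[s' + ->]].
    rewrite inE => /andP[s'H _]; rewrite !inE; exact: lions_block_tag LC _ _ _ s'H.
  rewrite !inE => /andP[s'H /eqP s'0] xs' /existsP[t /and3P[tH /eqP et xt]].
  have := valP k; rewrite !inE -et -(lions_block_inj LC s'H tH xs' xt) s'0.
  by rewrite eqxx.
- move=> x; case: (lions_cover LC (f x)) => [[j xj]|[s sH xs]].
    by left; exists (inl j); rewrite inE.
  have [s0|s0] := eqVneq (g @^-1: s) set0.
    right; exists (f @^-1: s); last by rewrite inE.
    rewrite !inE; apply/andP; split; first by apply/set0Pn; exists x; rewrite inE.
    by apply: imset_f; rewrite inE sH s0 eqxx.
  have kH : g @^-1: s \in restrH g by rewrite !inE s0 imset_f.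
  left; exists (inr (exist (fun k => k \in restrH g) _ kH)); rewrite inE.
  by apply/existsP; exists s; rewrite sH eqxx.
- move=> _ /prune_nonempty[s ns ->] x y; rewrite !inE => xs ys lt.
  have [m ym] := depth_gt0 (leq_ltn_trans (leq0n _) lt).
  have dy := depth_edge fP ym; have ymE := ym; rewrite edgeP in ymE.
  exists m => //; rewrite inE; apply: (prune_step ns ys xs ymE) => w xw ws wm.
  have /imf[v ev] := down_edge wm (fA m); subst w.
  have := depth_le_connect fP (bottom_connect xw).
  rewrite (depth_edge fP (y := m)) ?edgeP // -dy leqNgt lt //.
- move=> _ /prune_nonempty[s ns ->] x1 y1 x2 y2; rewrite !inE /=.
  have half a b a2 b2 : f a \in s -> f b \in s ->
      depth (restrE f) a = depth (restrE f) b ->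
      edge E (f a) (f a2) -> edge E (f b) (f b2) -> a2 <> b2 -> f a2 \in s.
    move=> sa sb dab aa bb nab.
    apply: (prune_step ns sa sb aa) => w bw ws wa.
    have /imf[v ev] := down_edge wa (fA a2); subst w.
    have cbv := bottom_connect bw.
    have ebv : b = v.
      rewrite -edgeP in wa; rewrite -edgeP in aa.
      by apply: (connect_depth_eq fP cbv); rewrite -dab (depth_edge fP aa)
        (depth_edge fP wa).
    by apply: nab; apply: f_inj; apply: ((lions_forest LC).2 (f b)); rewrite // ebv.
  move=> xs ys d xx yy ne; split; first exact: half xs ys d xx yy ne.
  by apply: half ys xs (esym d) yy xx _ => /esym.
move=> [j|k] x.
  rewrite inE; have [n] := ubnP (depth (restrE f) x).
  elim: n x => // n IHn x lt_xn xj; case: (boolP (is_root (restrE f) x)).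
    by move=> rx; exists x; rewrite ?inE.
  case/rootPn=> y xy; apply: (IHn y).
    by move: lt_xn; rewrite (depth_edge fP xy) ltnS.
  by apply: (lions_tag_up LC xj); rewrite -edgeP.
rewrite inE => /existsP[s /and3P[sH /eqP es xs]].
have /set0Pn[a] : val k != set0 by have := valP k; rewrite !inE => /andP[].
rewrite -es inE => sa; have ns := nonempty_block LC sH.
have [n] := ubnP (depth (restrE f) x).
elim: n x xs => // n IHn x xs lt_xn; case: (boolP (is_root (restrE f) x)).
  move=> rx; exists x => //; rewrite inE; apply/existsP; exists s.
  by rewrite sH es eqxx.
case/rootPn=> y xy; apply: (IHn y).
  rewrite edgeP in xy; apply: (prune_step ns xs sa xy) => w aw _ wy.
  by move/negP: (down_edge wy (fA y)); apply; apply: up_connect aw.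
by move: lt_xn; rewrite (depth_edge fP xy) ltnS.
Qed.

End Bottom.
End Restriction.

Lemma directed_forest_rank (N : finType) (E : {set N * N}) (r : N -> nat) :
    (forall x y, edge E x y -> (r y < r x)%N) ->
    (forall x y z, edge E x y -> edge E x z -> y = z) ->
  directed_forest E.
Proof.
move=> rE fE; split=> // x y /rE lt; apply/negP=> /connectP[p pp ex].
suff : (r x <= r y)%N by rewrite leqNgt lt.
rewrite {lt}ex; elim: p y pp => [|a p IHp] y //= /andP[/rE ya pp].
by apply: leq_trans (IHp a pp) (ltnW ya).
Qed.

Lemma empty_conditions (J : Type) :
  lions_conditions (set0 : {set 'I_0 * 'I_0}) (fun _ : J => set0) set0.
Proof.
apply: lions_conditions_intro.
- by split=> - [].
- by move=> j k [].
- by rewrite inE.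
- by move=> s t [].
- by move=> s j [].
- by case.
- by move=> s _ [].
- by move=> s _ [].
by move=> j [].
Qed.

Section Retag.
Variables (J K : Type) (N : finType) (E : {set N * N}).
Variables (h : J -> {set N}) (H : {set {set N}}) (g : J -> K).
Hypotheses (g_inj : injective g) (LC : lions_conditions E h H).

Definition retagh (k : K) : {set N} :=
  [set x | `[< exists2 j, g j = k & x \in h j >]].

Lemma retaghE j : retagh (g j) = h j.
Proof.
apply/setP=> x; rewrite inE; apply/asboolP/idP => [[i /g_inj->]|] //.
by exists j.
Qed.

Lemma retag_conditions : lions_conditions E retagh H.
Proof.
have nonE s : nonempty_hyperedge retagh H s -> nonempty_hyperedge h H s.
  case=> s0 [sH|[k es]]; first exact: nonempty_block LC _ sH.
  case/set0Pn: s0 => x; rewrite es inE => /asboolP[j ek xj].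
  by rewrite -ek retaghE; apply: nonempty_tag xj.
apply: lions_conditions_intro.
- exact: lions_forest LC.
- move=> j k x; rewrite !inE => /asboolP[i <- xi] /asboolP[i' <- xi'].
  by rewrite (lions_tag_inj LC xi xi').
- exact: lions_set0 LC.
- exact: lions_block_inj LC.
- move=> s k x sH xs; rewrite inE => /asboolP[j _ xj].
  exact: (lions_block_tag LC sH xs xj).
- move=> x; case: (lions_cover LC x) => [[j xj]|]; last by right.
  by left; exists (g j); rewrite retaghE.
- by move=> s /nonE; apply: lions_climb LC _.
- by move=> s /nonE; apply: lions_parents LC _.
move=> k x; rewrite inE => /asboolP[j <- xj]; rewrite retaghE.
by apply: (lions_tag_root LC); apply/set0Pn; exists x.
Qed.

End Retag.

Section Rooting.
Variables (n : nat) (E : {set 'I_n * 'I_n}).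
Variables (h : unit -> {set 'I_n}) (H : {set {set 'I_n}}).
Hypothesis LC : lions_conditions E h H.

Let up : 'I_n -> 'I_n.+1 := lift ord0.

Definition rootE : {set 'I_n.+1 * 'I_n.+1} :=
  [set (up e.1, up e.2) | e in E] :|: [set (up x, ord0) | x in is_root E].

Definition rooth (_ : unit) : {set 'I_n.+1} := ord0 |: up @: h tt.

Definition rootH : {set {set 'I_n.+1}} := [set up @: s | s : {set 'I_n} in H].

Let up_inj : injective up := @lift_inj _ ord0.

Lemma rooting_edge x z : edge rootE x z <->
  (exists a b, [/\ x = up a, z = up b & edge E a b]) \/
  (exists a, [/\ x = up a, z = ord0 & is_root E a]).
Proof.
rewrite /edge inE; split.
  case/orP=> /imsetP[]; first by move=> [a b] ab [-> ->]; left; exists a, b.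
  by move=> a ra [-> ->]; right; exists a.
case=> [[a [b [-> -> ab]]]|[a [-> -> ra]]]; apply/orP.
  by left; apply/imsetP; exists (a, b).
by right; apply/imsetP; exists a.
Qed.

Lemma rooting_edge_up a b : edge rootE (up a) (up b) = edge E a b.
Proof.
apply/idP/idP=> [|ab]; last by apply/rooting_edge; left; exists a, b.
case/rooting_edge=> [[c [e [/up_inj-> /up_inj->]]] //|[c [_]]].
by move/eqP; rewrite eq_sym (negbTE (neq_lift _ _)).
Qed.

Lemma rooting_root0 : is_root rootE ord0.
Proof.
apply/forallP=> y; apply/negP=> /rooting_edge.
by case=> [[c [e [/eqP]]]|[c [/eqP]]]; rewrite (negbTE (neq_lift _ _)).
Qed.

Lemma rooting_parent a : exists z, edge rootE (up a) z.
Proof.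
case: (boolP (is_root E a)) => [ra|/rootPn[b ab]].
  by exists ord0; apply/rooting_edge; right; exists a.
by exists (up b); rewrite rooting_edge_up.
Qed.

Lemma rooting_forest : directed_forest rootE.
Proof.
have fE := lions_forest LC.
apply: (@directed_forest_rank _ _
  (fun x => if unlift ord0 x is Some a then (depth E a).+1 else 0%N)).
  move=> x y /rooting_edge[[a [b [-> -> ab]]]|[a [-> -> _]]].
    by rewrite !liftK (depth_edge fE ab).
  by rewrite liftK unlift_none.
move=> x y z /rooting_edge xy /rooting_edge xz.
case: xy xz => [[a [b [-> -> ab]]]|[a [-> -> ra]]].
  case=> [[a' [b' [/up_inj<- -> ab']]]|[a' [/up_inj<- _]]].
    by rewrite (fE.2 a b b').
  by move/forallP/(_ b); rewrite ab.
case=> [[a' [b' [/up_inj<- _ ab']]]|[a' [_ -> _]]] //.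
by move/forallP/(_ b'): ra; rewrite ab'.
Qed.

Lemma rooting_depth a : depth rootE (up a) = (depth E a).+1.
Proof.
rewrite (@depth_map _ _ E rootE up 1) ?addn1 //.
- exact: lions_forest LC.
- exact: rooting_forest.
- by move=> x y; rewrite rooting_edge_up.
move=> x rx; rewrite (depth_edge rooting_forest (y := ord0)).
  by rewrite depth_root // rooting_root0.
by apply/rooting_edge; right; exists x.
Qed.

Lemma rooting_nonempty s : nonempty_hyperedge rooth rootH s ->
  s = rooth tt \/ exists2 t, t \in H & s = up @: t.
Proof. by case=> _ [/imsetP[t tH ->]|[[] ->]]; [right; exists t|left]. Qed.

Lemma rooting_up x z : x \in rooth tt -> edge rootE x z -> z \in rooth tt.
Proof.
rewrite !inE => xs /rooting_edge[[a [b [ex -> ab]]]|[a [_ -> _]]]; last first.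
  by rewrite eqxx.
apply/orP; right; apply: imset_f; apply: (lions_tag_up LC) ab.
move: xs; rewrite ex eq_sym (negbTE (neq_lift _ _)) /=.
by case/imsetP=> a' ha' /up_inj->.
Qed.

Lemma rooting_conditions : lions_conditions rootE rooth rootH.
Proof.
apply: lions_conditions_intro.
- exact: rooting_forest.
- by move=> [] [].
- apply/imsetP=> -[t tH /esym/eqP]; rewrite imset_eq0 => /eqP t0.
  by move: (lions_set0 LC); rewrite -t0 tH.
- move=> _ _ x /imsetP[s sH ->] /imsetP[t tH ->] /imsetP[a sa ->].
  by case/imsetP=> b tb /up_inj eab; rewrite (lions_block_inj LC sH tH sa) // eab.
- move=> _ [] _ /imsetP[s sH ->] /imsetP[a sa ->].
  rewrite !inE eq_sym (negbTE (neq_lift _ _)) /= => /imsetP[b hb /up_inj eab].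
  by apply: (lions_block_tag LC sH sa); rewrite eab; apply: hb.
- move=> x; case: (unliftP ord0 x) => [a ->|->].
    case: (lions_cover LC a) => [[[] ha]|[s sH sa]].
      by left; exists tt; rewrite !inE; apply/orP; right; apply: imset_f.
    by right; exists (up @: s); [apply: imset_f | apply: imset_f].
  by left; exists tt; rewrite !inE eqxx.
- move=> s /rooting_nonempty[->|[t tH ->]] x y.
    move=> _ ys lt; have [z yz] := depth_gt0 (leq_ltn_trans (leq0n _) lt).
    by exists z => //; apply: rooting_up yz.
  move=> /imsetP[a ta ->] /imsetP[b tb ->]; rewrite !rooting_depth ltnS => lt.
  have [c tc bc] := lions_climb LC (nonempty_block LC tH) ta tb lt.
  exists (up c); first exact: imset_f.
  by move: bc; rewrite -/(edge _ _ _) -rooting_edge_up.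
- move=> s /rooting_nonempty[->|[t tH ->]] x1 y1 x2 y2.
    by move=> xs ys _ xx yy _; split; [apply: rooting_up xx|apply: rooting_up yy].
  move=> /imsetP[a ta ->] /imsetP[b tb ->]; rewrite !rooting_depth => -[dab].
  have nt := nonempty_block LC tH.
  move=> /rooting_edge[[a' [a2 [/up_inj<- -> aa]]]|[a' [/up_inj<- -> ra]]].
    move=> /rooting_edge[[b' [b2 [/up_inj<- -> bb]]]|[b' [/up_inj<- -> rb]]].
      move=> ne; have [|sa sb] := lions_parents LC nt ta tb dab aa bb.
        by move=> e; apply: ne; rewrite e.
      by split; apply: imset_f.
    by move: dab; rewrite (depth_edge (lions_forest LC) aa) (depth_root rb).
  move=> /rooting_edge[[b' [b2 [/up_inj<- -> bb]]]|[b' [/up_inj<- -> rb]]] //.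
  by move: dab; rewrite (depth_edge (lions_forest LC) bb) (depth_root ra).
by move=> [] x _; exists ord0; rewrite ?inE ?eqxx // rooting_root0.
Qed.

End Rooting.

Section Product.
Variables (J : Type) (N1 N2 N : finType) (f1 : N1 -> N) (f2 : N2 -> N).
Hypotheses (f1_inj : injective f1) (f2_inj : injective f2).
Hypothesis f12 : forall x y, f1 x <> f2 y.
Hypothesis f_cover : forall z, (exists x, z = f1 x) \/ (exists y, z = f2 y).
Variables (E1 : {set N1 * N1}) (h1 : J -> {set N1}) (H1 : {set {set N1}}).
Variables (E2 : {set N2 * N2}) (h2 : J -> {set N2}) (H2 : {set {set N2}}).
Hypotheses (LC1 : lions_conditions E1 h1 H1) (LC2 : lions_conditions E2 h2 H2).

Definition prodE : {set N * N} :=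
  [set (f1 e.1, f1 e.2) | e in E1] :|: [set (f2 e.1, f2 e.2) | e in E2].

Definition prodh (j : J) : {set N} := f1 @: h1 j :|: f2 @: h2 j.

Definition prodH : {set {set N}} :=
  [set f1 @: s | s : {set N1} in H1] :|: [set f2 @: s | s : {set N2} in H2].

Lemma prod_edge x z : edge prodE x z <->
  (exists a b, [/\ x = f1 a, z = f1 b & edge E1 a b]) \/
  (exists a b, [/\ x = f2 a, z = f2 b & edge E2 a b]).
Proof.
rewrite /edge inE; split.
  by case/orP=> /imsetP[[a b] ab [-> ->]]; [left | right]; exists a, b.
by case=> -[a [b [-> -> ab]]]; apply/orP; [left | right];
  apply/imsetP; exists (a, b).
Qed.

Lemma prod_edge1 a z : edge prodE (f1 a) z <-> exists2 b, z = f1 b & edge E1 a b.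
Proof.
split=> [/prod_edge[[c [b [/f1_inj<- -> ab]]]|[c [b [/f12]]]] //|[b -> ab]].
  by exists b.
by apply/prod_edge; left; exists a, b.
Qed.

Lemma prod_edge2 a z : edge prodE (f2 a) z <-> exists2 b, z = f2 b & edge E2 a b.
Proof.
split=> [/prod_edge[[c [b [/esym/f12]]]|[c [b [/f2_inj<- -> ab]]]] //|[b -> ab]].
  by exists b.
by apply/prod_edge; right; exists a, b.
Qed.

Lemma prod_root1 a : is_root E1 a -> is_root prodE (f1 a).
Proof.
move=> ra; apply/forallP=> z; apply/negP=> /prod_edge1[b _ ab].
by move/forallP/(_ b): ra; rewrite ab.
Qed.

Lemma prod_root2 a : is_root E2 a -> is_root prodE (f2 a).
Proof.
move=> ra; apply/forallP=> z; apply/negP=> /prod_edge2[b _ ab].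
by move/forallP/(_ b): ra; rewrite ab.
Qed.

Lemma prod_forest : directed_forest prodE.
Proof.
have [[_ u1] [_ u2]] := (lions_forest LC1, lions_forest LC2).
pose r z := if [pick x | z == f1 x] is Some x then depth E1 x else
  if [pick y | z == f2 y] is Some y then depth E2 y else 0%N.
have r1 a : r (f1 a) = depth E1 a.
  by rewrite /r; case: pickP => [b /eqP/f1_inj->|/(_ a)] //; rewrite eqxx.
have r2 a : r (f2 a) = depth E2 a.
  rewrite /r; case: pickP => [b /eqP/esym/f12|_] //.
  by case: pickP => [b /eqP/f2_inj->|/(_ a)] //; rewrite eqxx.
apply: (@directed_forest_rank _ _ r) => [x y|x y z].
  move=> /prod_edge[[a [b [-> -> ab]]]|[a [b [-> -> ab]]]].
    by rewrite !r1 (depth_edge (lions_forest LC1) ab).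
  by rewrite !r2 (depth_edge (lions_forest LC2) ab).
move=> /prod_edge[[a [b [-> -> ab]]]|[a [b [-> -> ab]]]].
  by case/prod_edge1=> c -> /(u1 _ _ _ ab)->.
by case/prod_edge2=> c -> /(u2 _ _ _ ab)->.
Qed.

Lemma prod_depth1 a : depth prodE (f1 a) = depth E1 a.
Proof.
rewrite (@depth_map _ _ E1 prodE f1 0) ?addn0 //.
- exact: lions_forest LC1.
- exact: prod_forest.
- by move=> x y xy; apply/prod_edge1; exists y.
by move=> x /prod_root1/depth_root.
Qed.

Lemma prod_depth2 a : depth prodE (f2 a) = depth E2 a.
Proof.
rewrite (@depth_map _ _ E2 prodE f2 0) ?addn0 //.
- exact: lions_forest LC2.
- exact: prod_forest.
- by move=> x y xy; apply/prod_edge2; exists y.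
by move=> x /prod_root2/depth_root.
Qed.

Lemma prod_nonempty s : nonempty_hyperedge prodh prodH s ->
  [\/ exists j, s = prodh j, exists2 t, t \in H1 & s = f1 @: t |
      exists2 t, t \in H2 & s = f2 @: t].
Proof.
case=> _ [|[j ->]]; last by constructor 1; exists j.
rewrite inE => /orP[]/imsetP[t tH ->]; first by constructor 2; exists t.
by constructor 3; exists t.
Qed.

Lemma prodhP j z : z \in prodh j <->
  (exists2 a, z = f1 a & a \in h1 j) \/ (exists2 a, z = f2 a & a \in h2 j).
Proof.
rewrite inE; split=> [/orP[]/imsetP[a ha ->]|[][a -> ha]].
- by left; exists a.
- by right; exists a.
- by rewrite imset_f.
by rewrite imset_f ?orbT.
Qed.

Lemma prod_up j x z : x \in prodh j -> edge prodE x z -> z \in prodh j.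
Proof.
move=> /prodhP[][a -> ha].
  case/prod_edge1=> b -> ab; apply/prodhP; left; exists b => //.
  exact: lions_tag_up LC1 _ _ _ ha ab.
case/prod_edge2=> b -> ab; apply/prodhP; right; exists b => //.
exact: lions_tag_up LC2 _ _ _ ha ab.
Qed.

Lemma prod_conditions : lions_conditions prodE prodh prodH.
Proof.
apply: lions_conditions_intro.
- exact: prod_forest.
- move=> j k x /prodhP[][a -> ha] /prodhP[][b e hb].
  + by move/f1_inj: e => e; subst b; apply: lions_tag_inj LC1 _ _ _ ha hb.
  + by case: (f12 e).
  + by case: (f12 (esym e)).
  + by move/f2_inj: e => e; subst b; apply: lions_tag_inj LC2 _ _ _ ha hb.
- rewrite inE negb_or; apply/andP; split; apply/imsetP=> -[t tH /esym/eqP].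
    by rewrite imset_eq0 => /eqP t0; move: (lions_set0 LC1); rewrite -t0 tH.
  by rewrite imset_eq0 => /eqP t0; move: (lions_set0 LC2); rewrite -t0 tH.
- move=> s t x; rewrite !inE => /orP[]/imsetP[s' sH ->] /orP[]/imsetP[t' tH ->].
  + move=> /imsetP[a sa ->] /imsetP[b tb /f1_inj e]; subst b.
    by rewrite (lions_block_inj LC1 sH tH sa tb).
  + by move=> /imsetP[a sa ->] /imsetP[b tb /f12].
  + by move=> /imsetP[a sa ->] /imsetP[b tb /esym/f12].
  + move=> /imsetP[a sa ->] /imsetP[b tb /f2_inj e]; subst b.
    by rewrite (lions_block_inj LC2 sH tH sa tb).
- move=> s j x; rewrite inE => /orP[]/imsetP[s' sH ->] /imsetP[a sa ->].
    case/prodhP=> -[b e hb]; last by case: (f12 e).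
    by move/f1_inj: e => e; subst b; apply: lions_block_tag LC1 _ _ _ sH sa hb.
  case/prodhP=> -[b e hb]; first by case: (f12 (esym e)).
  by move/f2_inj: e => e; subst b; apply: lions_block_tag LC2 _ _ _ sH sa hb.
- move=> x; case: (f_cover x) => -[a ->].
    case: (lions_cover LC1 a) => [[j ha]|[s sH sa]].
      by left; exists j; apply/prodhP; left; exists a.
    by right; exists (f1 @: s); [rewrite inE imset_f | apply: imset_f].
  case: (lions_cover LC2 a) => [[j ha]|[s sH sa]].
    by left; exists j; apply/prodhP; right; exists a.
  by right; exists (f2 @: s); [rewrite inE imset_f ?orbT | apply: imset_f].
- move=> s /prod_nonempty[[j ->]|[t tH ->]|[t tH ->]] x y.
  + move=> _ ys lt; have [z yz] := depth_gt0 (leq_ltn_trans (leq0n _) lt).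
    by exists z => //; apply: prod_up yz.
  + move=> /imsetP[a ta ->] /imsetP[b tb ->]; rewrite !prod_depth1 => lt.
    have [c tc bc] := lions_climb LC1 (nonempty_block LC1 tH) ta tb lt.
    exists (f1 c); first exact: imset_f.
    by apply/prod_edge1; exists c.
  + move=> /imsetP[a ta ->] /imsetP[b tb ->]; rewrite !prod_depth2 => lt.
    have [c tc bc] := lions_climb LC2 (nonempty_block LC2 tH) ta tb lt.
    exists (f2 c); first exact: imset_f.
    by apply/prod_edge2; exists c.
- move=> s /prod_nonempty[[j ->]|[t tH ->]|[t tH ->]] x1 y1 x2 y2.
  + by move=> xs ys _ xx yy _; split; [apply: prod_up xx|apply: prod_up yy].
  + move=> /imsetP[a ta ->] /imsetP[b tb ->]; rewrite !prod_depth1 => dab.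
    move=> /prod_edge1[a2 -> aa] /prod_edge1[b2 -> bb] ne.
    have [|sa sb] := lions_parents LC1 (nonempty_block LC1 tH) ta tb dab aa bb.
      by move=> e; apply: ne; rewrite e.
    by split; apply: imset_f.
  + move=> /imsetP[a ta ->] /imsetP[b tb ->]; rewrite !prod_depth2 => dab.
    move=> /prod_edge2[a2 -> aa] /prod_edge2[b2 -> bb] ne.
    have [|sa sb] := lions_parents LC2 (nonempty_block LC2 tH) ta tb dab aa bb.
      by move=> e; apply: ne; rewrite e.
    by split; apply: imset_f.
move=> j x /prodhP[][a _ ha].
  have [|r hr rr] := lions_tag_root LC1 (j := j); first by apply/set0Pn; exists a.
  by exists (f1 r); [apply/prodhP; left; exists r | apply: prod_root1].
have [|r hr rr] := lions_tag_root LC2 (j := j); first by apply/set0Pn; exists a.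
by exists (f2 r); [apply/prodhP; right; exists r | apply: prod_root2].
Qed.

End Product.

Record lforest (d : nat) (J : Type) : Type := LForest {
  nnodes : nat;
  label : 'I_nnodes -> 'I_d;
  edges : {set 'I_nnodes * 'I_nnodes};
  tagged : J -> {set 'I_nnodes};
  hyper : {set {set 'I_nnodes}};
  lforestP : lions_conditions edges tagged hyper
}.

HB.instance Definition _ d J := gen_eqMixin (lforest d J).
HB.instance Definition _ d J := gen_choiceMixin (lforest d J).

(* rel says which tag of T' each tag of T corresponds to. *)
Record lf_iso d (J J' : Type) (rel : J -> J' -> Prop) (T : lforest d J)
    (T' : lforest d J') (f : 'I_(nnodes T) -> 'I_(nnodes T')) : Prop := LfIso {
  iso_bij : bijective f;
  iso_label : forall x, label (f x) = label x;
  iso_edge : forall x y, edge (edges T') (f x) (f y) = edge (edges T) x y;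
  iso_tagged : forall j j', rel j j' -> tagged T' j' = f @: tagged T j;
  iso_hyper : hyper T' = [set f @: s | s : {set _} in hyper T]
}.

Section IsoTheory.
Variable d : nat.

Lemma lf_iso_refl J (rel : J -> J -> Prop) (T : lforest d J) :
  (forall j j', rel j j' -> j = j') -> lf_iso rel (T := T) (T' := T) id.
Proof.
move=> relE; split=> //.
- by exists id.
- by move=> j j' /relE->; rewrite imset_id.
by rewrite (eq_imset (g := id)) ?imset_id // => s; rewrite imset_id.
Qed.

Lemma lf_iso_sym J J' (rel : J -> J' -> Prop) (rel' : J' -> J -> Prop)
    (T : lforest d J) (T' : lforest d J') f g :
    (forall j j', rel' j' j -> rel j j') ->
    lf_iso rel (T := T) (T' := T') f -> cancel f g -> cancel g f ->
  lf_iso rel' (T := T') (T' := T) g.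
Proof.
move=> relE [bf lf ef tf hf] fK gK; split=> //.
- by exists f.
- by move=> x; rewrite -{2}(gK x) lf.
- by move=> x y; rewrite -ef !gK.
- by move=> j j' /relE/tf->; rewrite -imset_comp (eq_imset (g := id)) ?imset_id.
rewrite hf -imset_comp (eq_imset (g := id)) ?imset_id // => s /=.
by rewrite -imset_comp (eq_imset (g := id)) ?imset_id.
Qed.

Lemma lf_iso_trans J1 J2 J3 (r12 : J1 -> J2 -> Prop) (r23 : J2 -> J3 -> Prop)
    (r13 : J1 -> J3 -> Prop) (T1 : lforest d J1) (T2 : lforest d J2)
    (T3 : lforest d J3) f g :
    (forall j k, r13 j k -> exists2 i, r12 j i & r23 i k) ->
    lf_iso r12 (T := T1) (T' := T2) f -> lf_iso r23 (T := T2) (T' := T3) g ->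
  lf_iso r13 (T := T1) (T' := T3) (g \o f).
Proof.
move=> relE [bf lf ef tf hf] [bg lg eg tg hg]; split.
- exact: bij_comp.
- by move=> x; rewrite /= lg lf.
- by move=> x y; rewrite /= eg ef.
- by move=> j k /relE[i /tf e /tg->]; rewrite e -imset_comp.
rewrite hg hf -imset_comp; apply: eq_imset => s /=; by rewrite -imset_comp.
Qed.

End IsoTheory.

Section Forest.
Variables (d : nat) (J : Type).

Definition lf_equiv : rel (lforest d J) := fun T T' =>
  `[< exists f, lf_iso eq (T := T) (T' := T') f >].

Lemma lf_equiv_refl : reflexive lf_equiv.
Proof. by move=> T; apply/asboolP; exists id; apply: lf_iso_refl. Qed.

Lemma lf_equiv_sym : symmetric lf_equiv.
Proof.
have half T T' : lf_equiv T T' -> lf_equiv T' T.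
  move=> /asboolP[f iso]; have [g fK gK] := iso_bij iso.
  by apply/asboolP; exists g; apply: lf_iso_sym iso fK gK.
by move=> T T'; apply/idP/idP; apply: half.
Qed.

Lemma lf_equiv_trans : transitive lf_equiv.
Proof.
move=> T2 T1 T3 /asboolP[f iso12] /asboolP[g iso23]; apply/asboolP.
by exists (g \o f); apply: lf_iso_trans iso12 iso23 => j _ <-; exists j.
Qed.

Canonical lf_equiv_equiv :=
  EquivRel lf_equiv lf_equiv_refl lf_equiv_sym lf_equiv_trans.

Definition Forest : Type := {eq_quot lf_equiv}.

HB.instance Definition _ := Choice.on Forest.
HB.instance Definition _ := Quotient.on Forest.
HB.instance Definition _ : EqQuotient _ lf_equiv Forest := EqQuotient.on Forest.

End Forest.

(* A coupled pair may use the hyperedges of its lower forest as extra tags. *)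
Definition htag d J (Y : lforest d J) : Type := {k | k \in hyper Y}.

(* A representative of the pair written (upper, lower). *)
Record cpair (d : nat) (I : Type) : Type := CPair {
  lower : lforest d I;
  upper : lforest d (I + htag lower)
}.

HB.instance Definition _ d I := gen_eqMixin (cpair d I).
HB.instance Definition _ d I := gen_choiceMixin (cpair d I).

Definition htag_rel d I I' (Y : lforest d I) (Y' : lforest d I')
    (f : 'I_(nnodes Y) -> 'I_(nnodes Y')) (k : htag Y) (k' : htag Y') : Prop :=
  val k' = f @: val k.

Definition sum_rel A A' B B' (ra : A -> A' -> Prop) (rb : B -> B' -> Prop)
    (t : A + B) (t' : A' + B') : Prop :=
  match t, t' with
  | inl a, inl a' => ra a a'
  | inr b, inr b' => rb b b'
  | _, _ => False
  end.

Section HtagTheory.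
Variable d : nat.

Lemma htag_rel_id I (Y : lforest d I) (k k' : htag Y) :
  htag_rel (Y := Y) (Y' := Y) id k k' -> k = k'.
Proof. by rewrite /htag_rel imset_id => e; apply: val_inj. Qed.

Lemma htag_rel_sym I (Y Y' : lforest d I) f g k k' : cancel g f ->
  htag_rel (Y := Y') (Y' := Y) g k' k -> htag_rel (Y := Y) (Y' := Y') f k k'.
Proof.
by move=> gK; rewrite /htag_rel => ->; rewrite -imset_comp
  (eq_imset (g := id)) ?imset_id.
Qed.

Lemma htag_rel_trans I (Y1 Y2 Y3 : lforest d I) rel f g k k'' :
    lf_iso rel (T := Y1) (T' := Y2) f ->
    htag_rel (Y := Y1) (Y' := Y3) (g \o f) k k'' ->
  exists2 k', htag_rel (Y := Y1) (Y' := Y2) f k k' &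
    htag_rel (Y := Y2) (Y' := Y3) g k' k''.
Proof.
move=> iso e; have kH : f @: val k \in hyper Y2.
  by rewrite (iso_hyper iso); apply/imset_f/(valP k).
exists (exist (fun s => s \in hyper Y2) _ kH) => //.
by rewrite /htag_rel e /= -imset_comp.
Qed.

Lemma sum_rel_eq A B (ra : A -> A -> Prop) (rb : B -> B -> Prop) :
    (forall a a', ra a a' -> a = a') -> (forall b b', rb b b' -> b = b') ->
  forall t t', sum_rel ra rb t t' -> t = t'.
Proof. by move=> ea eb [a|b] [a'|b'] //= => [/ea->|/eb->]. Qed.

Lemma sum_rel_sub A A' B B' (ra ra' : A -> A' -> Prop) (rb rb' : B -> B' -> Prop) :
    (forall a a', ra a a' -> ra' a a') -> (forall b b', rb b b' -> rb' b b') ->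
  forall t t', sum_rel ra rb t t' -> sum_rel ra' rb' t t'.
Proof. by move=> ea eb [a|b] [a'|b'] //=; [apply: ea|apply: eb]. Qed.

Lemma sum_rel_swap A A' B B' (ra : A -> A' -> Prop) (ra' : A' -> A -> Prop)
    (rb : B -> B' -> Prop) (rb' : B' -> B -> Prop) :
    (forall a a', ra' a' a -> ra a a') -> (forall b b', rb' b' b -> rb b b') ->
  forall t t', sum_rel ra' rb' t' t -> sum_rel ra rb t t'.
Proof. by move=> ea eb [a|b] [a'|b'] //=; [apply: ea|apply: eb]. Qed.

Lemma sum_rel_trans A1 A2 A3 B1 B2 B3
    (ra12 : A1 -> A2 -> Prop) (ra23 : A2 -> A3 -> Prop) (ra13 : A1 -> A3 -> Prop)
    (rb12 : B1 -> B2 -> Prop) (rb23 : B2 -> B3 -> Prop) (rb13 : B1 -> B3 -> Prop) :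
    (forall a c, ra13 a c -> exists2 b, ra12 a b & ra23 b c) ->
    (forall a c, rb13 a c -> exists2 b, rb12 a b & rb23 b c) ->
  forall t v, sum_rel ra13 rb13 t v ->
    exists2 u, sum_rel ra12 rb12 t u & sum_rel ra23 rb23 u v.
Proof.
move=> ea eb [a|b] [a'|b'] //= => [/ea|/eb] [m m1 m2].
  by exists (inl m).
by exists (inr m).
Qed.

End HtagTheory.

Section CoupledPair.
Variables (d : nat) (I : Type).

(* Coupled pairs are taken up to isomorphisms of the two forests that are
   compatible with the tagging of the upper one by hyperedges of the lower one. *)
Definition cp_equiv : rel (cpair d I) := fun p p' =>
  `[< exists f g, lf_iso eq (T := lower p) (T' := lower p') f /\
        lf_iso (sum_rel eq (htag_rel f)) (T := upper p) (T' := upper p') g >].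

Lemma cp_equiv_refl : reflexive cp_equiv.
Proof.
move=> p; apply/asboolP; exists id, id; split; apply: lf_iso_refl => //.
by apply: sum_rel_eq => // k k'; apply: htag_rel_id.
Qed.

Lemma cp_equiv_sym : symmetric cp_equiv.
Proof.
have half p p' : cp_equiv p p' -> cp_equiv p' p.
  move=> /asboolP[f [g [isof isog]]].
  have [[f' fK f'K] [g' gK g'K]] := (iso_bij isof, iso_bij isog).
  apply/asboolP; exists f', g'; split; first exact: lf_iso_sym isof fK f'K.
  apply: lf_iso_sym isog gK g'K; apply: sum_rel_swap => // k k'.
  exact: htag_rel_sym.
by move=> p p'; apply/idP/idP; apply: half.
Qed.

Lemma cp_equiv_trans : transitive cp_equiv.
Proof.
move=> p2 p1 p3 /asboolP[f [g [isof isog]]] /asboolP[f' [g' [isof' isog']]].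
apply/asboolP; exists (f' \o f), (g' \o g); split.
  by apply: lf_iso_trans isof isof' => j _ <-; exists j.
apply: lf_iso_trans isog isog'; apply: sum_rel_trans => [j _ <-|k k''].
  by exists j.
exact: htag_rel_trans isof.
Qed.

Canonical cp_equiv_equiv :=
  EquivRel cp_equiv cp_equiv_refl cp_equiv_sym cp_equiv_trans.

Definition CoupledPair : Type := {eq_quot cp_equiv}.

HB.instance Definition _ := Choice.on CoupledPair.
HB.instance Definition _ := Quotient.on CoupledPair.
HB.instance Definition _ : EqQuotient _ cp_equiv CoupledPair := EqQuotient.on CoupledPair.

End CoupledPair.

(* A representative of ((upper1, upper2), (lower1, lower2)). *)
Record cpair2 (d : nat) (I : Type) : Type := CPair2 {
  lower1 : lforest d I;
  lower2 : lforest d I;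
  upper1 : lforest d (I + (htag lower1 + htag lower2));
  upper2 : lforest d (I + (htag lower1 + htag lower2))
}.

HB.instance Definition _ d I := gen_eqMixin (cpair2 d I).
HB.instance Definition _ d I := gen_choiceMixin (cpair2 d I).

Section CoupledPair2.
Variables (d : nat) (I : Type).

Definition cp2_equiv : rel (cpair2 d I) := fun p p' =>
  `[< exists f1 f2 g1 g2,
      let rel := sum_rel eq (sum_rel (htag_rel f1) (htag_rel f2)) in
      [/\ lf_iso eq (T := lower1 p) (T' := lower1 p') f1,
          lf_iso eq (T := lower2 p) (T' := lower2 p') f2,
          lf_iso rel (T := upper1 p) (T' := upper1 p') g1 &
          lf_iso rel (T := upper2 p) (T' := upper2 p') g2] >].

Lemma cp2_equiv_refl : reflexive cp2_equiv.
Proof.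
move=> p; apply/asboolP; exists id, id, id, id.
by split; apply: lf_iso_refl => //; apply: sum_rel_eq => //;
  apply: sum_rel_eq => k k'; apply: htag_rel_id.
Qed.

Lemma cp2_equiv_sym : symmetric cp2_equiv.
Proof.
have half p p' : cp2_equiv p p' -> cp2_equiv p' p.
  move=> /asboolP[f1 [f2 [g1 [g2 [if1 if2 ig1 ig2]]]]].
  have [[f1' f1K f1'K] [g1' g1K g1'K]] := (iso_bij if1, iso_bij ig1).
  have [[f2' f2K f2'K] [g2' g2K g2'K]] := (iso_bij if2, iso_bij ig2).
  apply/asboolP; exists f1', f2', g1', g2'; split.
  - exact: lf_iso_sym if1 f1K f1'K.
  - exact: lf_iso_sym if2 f2K f2'K.
  - apply: lf_iso_sym ig1 g1K g1'K; apply: sum_rel_swap => //.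
    by apply: sum_rel_swap => k k'; apply: htag_rel_sym.
  apply: lf_iso_sym ig2 g2K g2'K; apply: sum_rel_swap => //.
  by apply: sum_rel_swap => k k'; apply: htag_rel_sym.
by move=> p p'; apply/idP/idP; apply: half.
Qed.

Lemma cp2_equiv_trans : transitive cp2_equiv.
Proof.
move=> p2 p1 p3 /asboolP[f1 [f2 [g1 [g2 [if1 if2 ig1 ig2]]]]].
move=> /asboolP[f1' [f2' [g1' [g2' [if1' if2' ig1' ig2']]]]].
apply/asboolP; exists (f1' \o f1), (f2' \o f2), (g1' \o g1), (g2' \o g2); split.
- by apply: lf_iso_trans if1 if1' => j _ <-; exists j.
- by apply: lf_iso_trans if2 if2' => j _ <-; exists j.
- apply: lf_iso_trans ig1 ig1'; apply: sum_rel_trans => [j _ <-|]; first by exists j.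
  by apply: sum_rel_trans => k k''; apply: htag_rel_trans; [apply: if1|apply: if2].
apply: lf_iso_trans ig2 ig2'; apply: sum_rel_trans => [j _ <-|]; first by exists j.
by apply: sum_rel_trans => k k''; apply: htag_rel_trans; [apply: if1|apply: if2].
Qed.

Canonical cp2_equiv_equiv :=
  EquivRel cp2_equiv cp2_equiv_refl cp2_equiv_sym cp2_equiv_trans.

Definition CoupledPair2 : Type := {eq_quot cp2_equiv}.

HB.instance Definition _ := Choice.on CoupledPair2.
HB.instance Definition _ := Quotient.on CoupledPair2.
HB.instance Definition _ : EqQuotient _ cp2_equiv CoupledPair2 := EqQuotient.on CoupledPair2.

End CoupledPair2.

Section Cuts.
Variables (N : finType) (E : {set N * N}).

Definition tree (r : N) : {set N} := [set x | connect (edge E) x r].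

Definition tree_edges (r : N) : {set N * N} := [set e in E | e.1 \in tree r].

(* inl c is a cut by the set of edges c, inr true is the formal cut (∅, +) and
   inr false is the formal cut (∅, -). *)
Definition cut : finType := ({set N * N} + bool)%type.

Definition admissible (r : N) (c : cut) : bool :=
  match c with
  | inl c => [&& c != set0, c \subset tree_edges r &
      [forall x in tree r, #|root_path E x :&: c| <= 1]%N]
  | inr _ => true
  end.

Definition tree_cut_root (r : N) (c : cut) : {set N} :=
  match c with
  | inl c => [set x in tree r | root_path E x :&: c == set0]
  | inr true => tree r
  | inr false => set0
  end.

(* The component trees are indexed by their roots. *)
Definition forest_cut : finType := {ffun {r | is_root E r} -> cut}.

Definition forest_cuts : {set forest_cut} :=
  [set c : forest_cut | [forall r, admissible (val r) (c r)]].

Definition cut_root (c : forest_cut) : {set N} :=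
  \bigcup_r tree_cut_root (val r) (c r).

Definition cut_prune (c : forest_cut) : {set N} := ~: cut_root c.

Lemma cut_root_up (c : forest_cut) : directed_forest E ->
  forall x y, x \in cut_root c -> edge E x y -> y \in cut_root c.
Proof.
move=> fE x y /bigcupP[[r rr] _ /= xr] xy; apply/bigcupP.
exists (exist (fun r => is_root E r) r rr) => //=.
have tr : x \in tree r -> y \in tree r.
  rewrite !inE => /connectP[[|a p] /= pp er].
    by have /forallP/(_ y) := rr; rewrite er xy.
  case/andP: pp => xa pp; rewrite (fE.2 _ _ _ xy xa).
  by apply/connectP; exists p.
case: (c _) xr => [s|[]] /=; [|exact: tr|by rewrite inE].
rewrite in_set [in X in _ -> X]in_set => /andP[xr xs].
rewrite (tr xr) /= -subset0 -(eqP xs).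
by rewrite setSI // (root_path_edge fE xy) subsetUr.
Qed.

End Cuts.

Section CutForest.
Variables (d : nat) (J : Type) (T : lforest d J).
Variable c : forest_cut (edges T).

Let NR := cut_root c.
Let NP := cut_prune c.
Let fR : 'I_#|NR| -> 'I_(nnodes T) := enum_val.
Let fP : 'I_#|NP| -> 'I_(nnodes T) := enum_val.

Lemma cut_root_im y : y \in NR <-> exists m, y = fR m.
Proof.
split=> [yA|[m ->]]; last exact: enum_valP.
by exists (enum_rank_in yA y); rewrite /fR enum_rankK_in.
Qed.

Lemma cut_prune_im y : y \notin NR <-> exists m, y = fP m.
Proof.
split=> [yA|[m ->]]; last by have := enum_valP m; rewrite inE.
have yP : y \in NP by rewrite inE.
by exists (enum_rank_in yP y); rewrite /fP enum_rankK_in.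
Qed.

(* The nodes of the root and of the prune are numbered by enum_val, so that
   the preimage of a set of nodes of T by enum_val is its intersection with
   the nodes that are kept. *)
Definition root_part : lforest d J :=
  LForest (fun x => label (fR x))
    (top_conditions (lforestP T) (cut_root_up (lions_forest (lforestP T)))
      enum_val_inj cut_root_im).

Definition prune_part : lforest d (J + htag root_part) :=
  LForest (fun x => label (fP x))
    (bottom_conditions (lforestP T) (cut_root_up (lions_forest (lforestP T)))
      cut_root_im enum_val_inj cut_prune_im).

Definition cut_pair : cpair d J := CPair prune_part.

End CutForest.

Section Operators.
Variable d : nat.

Definition lf_empty (J : Type) : lforest d J :=
  LForest (fun x : 'I_0 => match notF (ltn_ord x) with end) (empty_conditions J).

(* Tags of K outside the range of g are left empty. *)
Definition retag J K (g : J -> K) (g_inj : injective g) (T : lforest d J) :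
    lforest d K :=
  LForest (@label _ _ T) (retag_conditions g_inj (lforestP T)).

(* The index set {0} is unit; the new root is ord0. *)
Definition lf_rooting (i : 'I_d) (T : lforest d unit) : lforest d unit :=
  LForest (fun x => if unlift ord0 x is Some y then label y else i)
    (rooting_conditions (lforestP T)).

Lemma const_unit_inj (I : Type) (iota : I) : injective (fun _ : unit => iota).
Proof. by move=> [] []. Qed.

Definition lf_tag I (iota : I) (T : lforest d unit) : lforest d I :=
  retag (@const_unit_inj _ iota) T.

Lemma split_cover m n (z : 'I_(m + n)) :
  (exists x, z = lshift n x) \/ (exists y, z = rshift m y).
Proof. by case: (split_ordP z) => x ->; [left | right]; exists x. Qed.

Lemma shift_neq m n (x : 'I_m) (y : 'I_n) : lshift n x <> rshift m y.
Proof. by move/eqP; rewrite eq_lrshift. Qed.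

Definition lf_prod J (T T' : lforest d J) : lforest d J :=
  LForest (fun x => match split x with inl y => label y | inr y => label y end)
    (prod_conditions (@lshift_inj _ _) (@rshift_inj _ _) (@shift_neq _ _)
       (@split_cover _ _) (lforestP T) (lforestP T')).

Definition sum_map A A' B B' (a : A -> A') (b : B -> B') (t : A + B) : A' + B' :=
  match t with inl x => inl (a x) | inr y => inr (b y) end.

Lemma sum_map_inj A A' B B' (a : A -> A') (b : B -> B') :
  injective a -> injective b -> injective (sum_map a b).
Proof. by move=> ia ib [x|x] [y|y] //= [] => [/ia->|/ib->]. Qed.

Definition cp_one I : cpair d I := CPair (lf_empty (I + htag (lf_empty I))).

Definition cp_with_one I (T : lforest d I) : cpair d I :=
  CPair (lower := lf_empty I) (retag (@inl_inj I (htag (lf_empty I))) T).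

Definition htag_lift i (Y : lforest d unit) (k : htag Y) :
    htag (lf_rooting i Y) :=
  exist (fun s => s \in hyper (lf_rooting i Y)) (lift ord0 @: val k)
    (imset_f _ (valP k)).

Lemma htag_lift_inj i (Y : lforest d unit) : injective (@htag_lift i Y).
Proof.
by move=> k l [/(imset_inj (@lift_inj _ ord0)) e]; apply: val_inj.
Qed.

Definition cp_rooting (i : 'I_d) (p : cpair d unit) : cpair d unit :=
  CPair (lower := lf_rooting i (lower p))
    (retag (sum_map_inj (@inj_id unit) (@htag_lift_inj i (lower p))) (upper p)).

Definition cp_tag I (iota : I) (p : cpair d unit) : cpair d I :=
  CPair (lower := lf_tag iota (lower p))
    (retag (sum_map_inj (@const_unit_inj _ iota) (@inj_id (htag (lower p))))
       (upper p)).

Definition cp_twist I (p1 p2 : cpair d I) : cpair2 d I :=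
  let H1 := htag (lower p1) in
  let H2 := htag (lower p2) in
  CPair2 (lower1 := lower p1) (lower2 := lower p2)
    (retag (sum_map_inj (@inj_id I) (@inl_inj H1 H2)) (upper p1))
    (retag (sum_map_inj (@inj_id I) (@inr_inj H1 H2)) (upper p2)).

Lemma htag_prod_subproof I (Y1 Y2 : lforest d I) (k : htag Y1 + htag Y2) :
  match k with
  | inl k => @lshift (nnodes Y1) (nnodes Y2) @: val k
  | inr k => @rshift (nnodes Y1) (nnodes Y2) @: val k
  end \in hyper (lf_prod Y1 Y2).
Proof.
by rewrite inE; case: k => k; rewrite imset_f ?orbT //; apply: (valP k).
Qed.

Definition htag_prod I (Y1 Y2 : lforest d I) (k : htag Y1 + htag Y2) :
    htag (lf_prod Y1 Y2) :=
  exist (fun s => s \in hyper (lf_prod Y1 Y2)) _ (htag_prod_subproof k).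

Lemma htag_prod_inj I (Y1 Y2 : lforest d I) : injective (@htag_prod I Y1 Y2).
Proof.
have neq (k1 : htag Y1) (k2 : htag Y2) :
    @lshift (nnodes Y1) (nnodes Y2) @: val k1 <> @rshift (nnodes Y1) (nnodes Y2) @: val k2.
  move=> e; have /set0Pn[x xk] : val k1 != set0.
    by apply: contraNneq (lions_set0 (lforestP Y1)) => <-; apply: (valP k1).
  have : @lshift (nnodes Y1) (nnodes Y2) x \in @rshift (nnodes Y1) (nnodes Y2) @: val k2 by rewrite -e imset_f.
  by case/imsetP=> y _ /shift_neq.
move=> [k|k] [l|l] [] e.
- by congr inl; apply/val_inj/(imset_inj (@lshift_inj _ _) e).
- by case: (neq k l e).
- by case: (neq l k (esym e)).
by congr inr; apply/val_inj/(imset_inj (@rshift_inj _ _) e).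
Qed.

Definition cp_prod I (p : cpair2 d I) : cpair d I :=
  CPair (lower := lf_prod (lower1 p) (lower2 p))
    (retag (sum_map_inj (@inj_id I) (@htag_prod_inj I (lower1 p) (lower2 p)))
       (lf_prod (upper1 p) (upper2 p))).

(* None of the following depends on the choice of the representatives. *)

Definition forest_one I : Forest d I := \pi_(Forest d I) (lf_empty I).

Definition rooting (i : 'I_d) (T : Forest d unit) : Forest d unit :=
  \pi_(Forest d unit) (lf_rooting i (repr T)).

Definition tag_op I (iota : I) (T : Forest d unit) : Forest d I :=
  \pi_(Forest d I) (lf_tag iota (repr T)).

Definition forest_prod I (T T' : Forest d I) : Forest d I :=
  \pi_(Forest d I) (lf_prod (repr T) (repr T')).

Definition pair_one I : CoupledPair d I := \pi_(CoupledPair d I) (cp_one I).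

Definition with_one I (T : Forest d I) : CoupledPair d I :=
  \pi_(CoupledPair d I) (cp_with_one (repr T)).

Definition id_rooting (i : 'I_d) (p : CoupledPair d unit) : CoupledPair d unit :=
  \pi_(CoupledPair d unit) (cp_rooting i (repr p)).

Definition tag_tag I (iota : I) (p : CoupledPair d unit) : CoupledPair d I :=
  \pi_(CoupledPair d I) (cp_tag iota (repr p)).

Definition twist I (p : CoupledPair d I * CoupledPair d I) : CoupledPair2 d I :=
  \pi_(CoupledPair2 d I) (cp_twist (repr p.1) (repr p.2)).

Definition prod_prod I (p : CoupledPair2 d I) : CoupledPair d I :=
  \pi_(CoupledPair d I) (cp_prod (repr p)).

End Operators.

(* The free left R-module on S. {malg R[S]} is a module in the library for non-trivial rings only. *)
Definition fspan (R : pzRingType) (S : choiceType) : Type := {malg R[S]}.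

Section Span.
Variables (R : pzRingType) (S : choiceType).

HB.instance Definition _ := GRing.Zmodule.on (fspan R S).

Definition span_scale (a : R) (u : fspan R S) : fspan R S :=
  [malg s in msupp u => a * u@_s].

Lemma span_scaleE a u s : (span_scale a u)@_s = a * u@_s.
Proof. by rewrite mcoeffE; case: msuppP => // _; rewrite mulr0. Qed.

Lemma span_scaleA a b u : span_scale a (span_scale b u) = span_scale (a * b) u.
Proof. by apply/malgP=> s; rewrite !span_scaleE mulrA. Qed.

Lemma span_scale1 : left_id 1 span_scale.
Proof. by move=> u; apply/malgP=> s; rewrite span_scaleE mul1r. Qed.

Lemma span_scaleDr : right_distributive span_scale +%R.
Proof. by move=> a u v; apply/malgP=> s; rewrite !(mcoeffD, span_scaleE) mulrDr. Qed.

Lemma span_scaleDl u : {morph span_scale^~ u : a b / a + b}.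
Proof. by move=> a b; apply/malgP=> s; rewrite !(mcoeffD, span_scaleE) mulrDl. Qed.

HB.instance Definition _ := GRing.Zmodule_isLmodule.Build R (fspan R S)
  span_scaleA span_scale1 span_scaleDr span_scaleDl.

Definition single (a : R) (s : S) : fspan R S := << a *g s >>.

Definition basis (s : S) : fspan R S := single 1 s.

Section LinearExtension.
Variables (M : lmodType R) (f : S -> M).

Definition linext (u : fspan R S) : M := \sum_(s <- msupp u) u@_s *: f s.

Lemma linextEw (D : {fset S}) (u : fspan R S) : (msupp u `<=` D)%fset ->
  linext u = \sum_(s <- D) u@_s *: f s.
Proof.
move=> sub; apply: big_fset_incl => // s _ /mcoeff_outdom->.
by rewrite scale0r.
Qed.

Lemma linext_is_linear : linear linext.
Proof.
move=> a u v; pose D := (msupp (a *: u + v) `|` (msupp u `|` msupp v))%fset.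
have sw : (msupp (a *: u + v) `<=` D)%fset by exact: fsubsetUl.
have su : (msupp u `<=` D)%fset.
  by apply: fsubset_trans (fsubsetUr _ _); apply: fsubsetUl.
have sv : (msupp v `<=` D)%fset.
  by apply: fsubset_trans (fsubsetUr _ _); apply: fsubsetUr.
rewrite (linextEw sw) (linextEw su) (linextEw sv).
rewrite scaler_sumr -big_split; apply: eq_bigr => s _ /=.
by rewrite mcoeffD span_scaleE scalerDl scalerA.
Qed.

HB.instance Definition _ :=
  GRing.isLinear.Build R (fspan R S) M *:%R linext linext_is_linear.

End LinearExtension.
End Span.

Definition linmap (R : pzRingType) (S S' : choiceType) (op : S -> S') :
  fspan R S -> fspan R S' := linext (fun s => basis R (op s)).

Definition tensor_map (R : pzRingType) (S1 S2 S1' S2' : choiceType)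
    (D1 : fspan R S1 -> fspan R S1') (D2 : fspan R S2 -> fspan R S2') :
    fspan R (S1 * S2)%type -> fspan R (S1' * S2')%type :=
  linext (fun s =>
    let u1 := D1 (basis R s.1) in
    let u2 := D2 (basis R s.2) in
    \sum_(p1 <- msupp u1) \sum_(p2 <- msupp u2)
      single (u1@_p1 * u2@_p2) (p1, p2)).

Section Delta.
Variables (R : pzRingType) (d : nat) (I : Type).

Definition Delta_basis (T : Forest d I) : fspan R (CoupledPair d I) :=
  if T == forest_one d I then basis R (pair_one d I)
  else \sum_(c in forest_cuts (edges (repr T)))
         basis R (\pi_(CoupledPair d I) (cut_pair c)).

Definition Delta : {linear fspan R (Forest d I) -> fspan R (CoupledPair d I)} :=
  linext Delta_basis.

End Delta.

Section Properties.
Variables (R : pzRingType) (d : nat).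

Definition compatible_rooting
    (D : fspan R (Forest d unit) -> fspan R (CoupledPair d unit)) : Prop :=
  forall (i : 'I_d) (T : Forest d unit),
    D (basis R (rooting i T)) =
    basis R (with_one (rooting i T)) + linmap (id_rooting i) (D (basis R T)).

(* D0 is the operator for the index set {0}. *)
Definition compatible_tag (I : Type)
    (D0 : fspan R (Forest d unit) -> fspan R (CoupledPair d unit))
    (D : fspan R (Forest d I) -> fspan R (CoupledPair d I)) : Prop :=
  forall (T : Forest d unit) (iota : I),
    D (basis R (tag_op iota T)) = linmap (tag_tag iota) (D0 (basis R T)).

Definition compatible_prod (I : Type)
    (D : fspan R (Forest d I) -> fspan R (CoupledPair d I)) : Prop :=
  forall T T' : Forest d I,
    D (basis R (forest_prod T T')) =
    linmap (@prod_prod d I)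
      (linmap (@twist d I) (tensor_map D D (basis R (T, T')))).

End Properties.

(* Main.v *)
From mathcomp Require Import all_boot all_algebra.
From mathcomp Require Import boolp finmap monalg.
Require Import Defs.

(** The proof replaces admissible cuts by upsets, that is, sets of nodes that
    contain the parent of each of their elements. Sending a cut [c] to its root
    part is a bijection from the cuts of a forest to its upsets: on a component
    tree, the whole tree and the empty set correspond to the two formal empty
    cuts, and any other upset is determined by the set of edges that leave its
    complement. Hence [Delta T] is the sum, over the upsets [A] of [T], of the
    class of the pair (prune, root) of [T] along [A] ([Delta_pi]); the empty
    forest is no exception, as its only upset is empty.

    The relation [cut_along A p] says that the pair [p] is obtained from [T] by
    restricting to the complement of [A] and to [A], without fixing how the
    nodes are numbered. It determines [p] up to isomorphism
    ([cut_along_uniq]) and is invariant under isomorphisms of [T] and of [p].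
    The identities (a), (b) and (c) then reduce to descriptions of upsets,
    each with the matching statement on pairs. The upsets of a rooted forest
    are the empty set, which gives (rooted forest, 1), and the upsets of the
    forest with the new root added ([sum_rooting_upsets], [rooting_along]).
    Changing tags does not affect upsets ([tag_along]). The upsets of a product
    are the unions of one upset of each factor ([sum_prod_upsets],
    [prod_along]).

    For uniqueness, every forest is built by products from forests with at most
    one non-empty tagged hyperedge, which are values of some [tag_op j]
    ([forest_ind]). If the tag [j] is used, split off the component trees whose
    root is tagged by [j]. Tagged hyperedges contain the ancestors of their
    nodes, so each of them is on one side of the splitting. A block that met
    both sides would, by the conditions of Lions forests, contain nodes of equal
    depth on the two sides together with all their ancestors, and therefore a
    root tagged by [j], which is impossible ([tag_trees_block]). *)

Set Implicit Arguments.
Unset Strict Implicit.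
Unset Printing Implicit Defensive.

Import GRing.Theory.
Local Open Scope ring_scope.
Local Open Scope quotient_scope.

(** * Cuts and upsets *)

Section Upsets.
Variables (N : finType) (E : {set N * N}).

(** Sets of nodes that are closed under passing to the parent. *)
Definition upset (A : {set N}) : bool :=
  [forall x in A, forall y, edge E x y ==> (y \in A)].

Lemma upsetP (A : {set N}) :
  reflect (forall x y, x \in A -> edge E x y -> y \in A) (upset A).
Proof.
apply: (iffP forall_inP) => [upA x y xA xy|upA x xA].
  by move: (upA x xA) => /forallP/(_ y); rewrite xy.
by apply/forallP=> y; apply/implyP; apply: upA.
Qed.

Hypothesis fE : directed_forest E.

Lemma connect_root r x : is_root E r -> connect (edge E) r x -> x = r.
Proof.
move=> /forallP rr /connectP[[|a p] //= /andP[ra _] _].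
by move: (rr a); rewrite ra.
Qed.

Lemma tree_root_exists x : exists2 r, is_root E r & x \in tree E r.
Proof.
have [n] := ubnP (depth E x); elim: n x => // n IHn x lt_xn.
case: (boolP (is_root E x)) => [rx|]; first by exists x; rewrite ?inE.
case/rootPn=> y xy; case: (IHn y) => [|r rr].
  by move: lt_xn; rewrite (depth_edge fE xy) ltnS.
by rewrite inE => yr; exists r; rewrite // inE (connect_trans (connect1 xy)).
Qed.

Lemma connect_linear x y z : connect (edge E) x y -> connect (edge E) x z ->
  connect (edge E) y z || connect (edge E) z y.
Proof.
case/connectP=> p; elim: p x => [|a p IHp] x /=; first by move=> _ -> ->.
case/andP=> xa pp ey /connectP[[|b q] /=].
  by move=> _ ->; rewrite orbC; apply/orP; left; apply/connectP;
    exists (a :: p); rewrite //= xa.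
case/andP=> xb pq ez; rewrite (fE.2 _ _ _ xb xa) in pq ez.
by apply: (IHp a pp ey); apply/connectP; exists q.
Qed.

Lemma tree_root_uniq x r r' : is_root E r -> is_root E r' ->
  x \in tree E r -> x \in tree E r' -> r = r'.
Proof.
rewrite !inE => rr rr' xr xr'.
by case/orP: (connect_linear xr xr') => /connect_root => [->|->].
Qed.

Lemma edge_tree x y r : edge E x y -> is_root E r ->
  (x \in tree E r) = (y \in tree E r).
Proof.
move=> xy rr; rewrite !inE; apply/idP/idP=> [xr|]; last first.
  by apply: connect_trans; apply: connect1.
case/connectP: xr rr => -[|a p] /= => [_ -> /forallP/(_ y)|]; first by rewrite xy.
case/andP=> xa pp er _; rewrite (fE.2 _ _ _ xy xa).
by apply/connectP; exists p.
Qed.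

Lemma upset_connect A x y : upset A -> x \in A -> connect (edge E) x y -> y \in A.
Proof. by move/upsetP=> upA; apply: up_connect. Qed.

(** Membership in the root part of a forest cut is decided in the component
    tree of the node. *)
Lemma mem_cut_root (c : forest_cut E) r x (rr : is_root E r) : x \in tree E r ->
  (x \in cut_root c) =
  (x \in tree_cut_root E r (c (exist (fun r => is_root E r) r rr))).
Proof.
move=> xr; apply/bigcupP/idP => [[[r' rr'] _ /= xr']|xc]; last first.
  by exists (exist (fun r => is_root E r) r rr).
have er : r' = r.
  apply: (@tree_root_uniq x) => //.
  by case: (c _) xr' => [s|[]] //=; rewrite inE // => /andP[].
by subst r'; rewrite (bool_irrelevance rr rr').
Qed.

(** The edges of the component tree of [r] that enter [A]. *)
Definition boundary (A : {set N}) (r : N) : {set N * N} :=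
  [set e in tree_edges E r | (e.1 \notin A) && (e.2 \in A)].

(** For an upset [A], the admissible cut of the component tree of [r] with root
    part [A :&: tree E r]; [inr true] and [inr false] are the formal cuts that keep
    the whole tree and nothing. *)
Definition upset_tree_cut (A : {set N}) (r : N) : cut N :=
  if tree E r \subset A then inr true
  else if r \in A then inl (boundary A r) else inr false.

(** The forest cut with root part [A]. *)
Definition upset_cut (A : {set N}) : forest_cut E :=
  [ffun r : {r | is_root E r} => upset_tree_cut A (val r)].

(** The path from a node outside an upset to a root in the upset enters the
    upset exactly once. *)
Lemma boundary_root_path A r x : upset A -> is_root E r ->
  x \in tree E r -> r \in A -> x \notin A ->
  exists2 e, e \in boundary A r & root_path E x :&: boundary A r = [set e].
Proof.
move=> upA rr; have [n] := ubnP (depth E x); elim: n x => // n IHn x lt_xn xr rA xA.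
have : ~~ is_root E x.
  apply: contra xA => rx; suff -> : x = r by [].
  by apply: (@tree_root_uniq x) => //; rewrite inE.
case/rootPn=> y xy; have yr := xr; rewrite (edge_tree xy rr) in yr.
have xyE : (x, y) \in tree_edges E r by rewrite inE xr andbT.
rewrite (root_path_edge fE xy).
case: (boolP (y \in A)) => yA.
  exists (x, y); first by rewrite inE xyE xA.
  apply/setP=> -[u v]; rewrite in_setI in_setU1 in_set1.
  have [[-> ->]|_] /= := eqVneq (u, v) (x, y); first by rewrite inE xyE xA.
  apply/negP=> /andP[]; rewrite [in X in X -> _]inE => /andP[_ /= yu].
  by rewrite inE => /andP[_ /andP[/= /negP]]; case; apply: upset_connect yu.
case: (IHn y) => // [|e ebd ee].
  by move: lt_xn; rewrite (depth_edge fE xy) ltnS.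
exists e => //; rewrite setIUl ee; apply/setUidPr/subsetP=> e'.
by rewrite !inE => /andP[/eqP-> /=]; rewrite (negbTE yA) !andbF.
Qed.

Lemma boundary_root_path0 A r x : upset A -> x \in A ->
  root_path E x :&: boundary A r = set0.
Proof.
move=> upA xA; apply/setP=> e; rewrite in_setI in_set0.
apply/negP=> /andP[]; rewrite inE => /andP[_ xe].
by rewrite inE (upset_connect upA xA xe) andbF.
Qed.

Lemma upset_cut_admissible A : upset A -> upset_cut A \in forest_cuts E.
Proof.
move=> upA; rewrite inE; apply/forallP=> -[r rr]; rewrite ffunE /= /upset_tree_cut.
case: ifP => // nsub; case: ifP => //= rA.
have /subsetPn[x xr xA] := negbT nsub.
have [e ebd _] := boundary_root_path upA rr xr rA xA.
apply/and3P; split.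
- by apply/set0Pn; exists e.
- by apply/subsetP=> e'; rewrite inE => /andP[].
apply/forall_inP=> y yr; case: (boolP (y \in A)) => yA.
  by rewrite boundary_root_path0 // cards0.
by have [e' _ ->] := boundary_root_path upA rr yr rA yA; rewrite cards1.
Qed.

Lemma upset_cutK A : upset A -> cut_root (upset_cut A) = A.
Proof.
move=> upA; apply/setP=> x; have [r rr xr] := tree_root_exists x.
rewrite (mem_cut_root _ rr xr) ffunE /= /upset_tree_cut.
case: ifP => [/subsetP/(_ x xr) -> //|_]; case: ifP => [rA|rA] /=.
  rewrite in_set xr /=; case: (boolP (x \in A)) => xA.
    by rewrite boundary_root_path0 // eqxx.
  have [e _ ->] := boundary_root_path upA rr xr rA xA.
  by apply/negbTE/set0Pn; exists e; rewrite inE.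
rewrite inE; apply/esym/negP=> xA; move/negP: rA; apply.
by apply: upset_connect xA _ => //; rewrite inE in xr.
Qed.

Lemma upset_cut_root (c : forest_cut E) : upset (cut_root c).
Proof. by apply/upsetP; apply: cut_root_up. Qed.

Lemma cut_rootK (c : forest_cut E) : c \in forest_cuts E -> upset_cut (cut_root c) = c.
Proof.
rewrite inE => /forallP admc; apply/ffunP=> -[r rr]; rewrite ffunE /=.
have memr x : x \in tree E r -> _ := mem_cut_root c rr.
have rr_tree : r \in tree E r by rewrite inE.
move: (admc (exist (fun r => is_root E r) r rr)) memr => /=.
rewrite /upset_tree_cut; case: (c _) => [s|[|]] /= adm memr.
- have rR : r \in cut_root c.
    rewrite memr // in_set rr_tree /= root_path_root // set0I //.
  case/and3P: adm => s0 /subsetP sE /forall_inP s1.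
  have notR x : x \in tree E r -> (x \notin cut_root c) = (root_path E x :&: s != set0).
    by move=> xr; rewrite memr // in_set xr.
  have head e : e \in s -> [/\ e.1 \in tree E r, e \in E & e \in root_path E e.1].
    by move/sE; rewrite in_set => /andP[eE er]; rewrite er eE inE eE connect0.
  rewrite rR ifF; last first.
    apply/negP=> /subsetP sub; case/set0Pn: s0 => e es.
    have [er eE ee] := head e es; have := sub _ er; apply/negP.
    by rewrite notR //; apply/set0Pn; exists e; rewrite inE ee.
  congr inl; apply/setP=> e; apply/idP/idP.
    rewrite in_set => /and3P[]; rewrite in_set => /andP[eE er] e1 e2.
    case: e eE er e1 e2 => x y /= xy xr; rewrite notR // => e1.
    have yr := xr; rewrite (edge_tree xy rr) in yr.
    apply: contraTT => xys; rewrite notR //; apply: contraNneq e1 => e0.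
    rewrite (root_path_edge fE xy) setIUl e0 setU0.
    apply/eqP/setP=> e; rewrite !inE; apply/negP=> /andP[/eqP-> es].
    by rewrite es in xys.
  move=> es; have [er eE ee] := head e es; rewrite in_set (sE _ es) /=.
  rewrite notR //; apply/andP; split; first by apply/set0Pn; exists e; rewrite inE ee.
  have xy : edge E e.1 e.2 by rewrite /edge -surjective_pairing.
  have yr := er; rewrite (edge_tree xy rr) in yr.
  (* If the cut is met again after [e], the path from [e.1] meets it twice. *)
  apply: contraTT (s1 _ er); rewrite notR // => /set0Pn[e']; rewrite in_setI => /andP[e'y e's].
  have ne : e != e'.
    apply: contraTneq e'y => <-; rewrite inE negb_and; apply/orP; right.
    exact: fE.1.
  rewrite -ltnNge; apply: leq_trans (_ : #|[set e; e']| <= _)%N.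
    by rewrite cards2 ne.
  apply/subset_leq_card/subsetP=> e''; rewrite !inE => /orP[]/eqP->.
    by rewrite es eE connect0.
  rewrite e's andbT; move: e'y; rewrite inE => /andP[-> ye'] /=.
  exact: connect_trans (connect1 xy) ye'.
- by rewrite ifT //; apply/subsetP=> x xr; rewrite memr.
have rN : r \notin cut_root c by rewrite memr // inE.
by rewrite (negbTE rN) ifF //; apply/negP=> /subsetP/(_ r rr_tree); apply/negP.
Qed.

Lemma sum_forest_cuts (V : zmodType) (F : {set N} -> V) :
  \sum_(c in forest_cuts E) F (cut_root c) = \sum_(A | upset A) F A.
Proof.
rewrite (reindex_onto (fun c => cut_root c) upset_cut); last exact: upset_cutK.
apply: eq_bigl => c; rewrite upset_cut_root /=; apply/idP/eqP => [/cut_rootK //|<-].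
exact/upset_cut_admissible/upset_cut_root.
Qed.

End Upsets.

(** * Pairs cut along an upset *)

(** Two injections with the same image differ by a bijection of their domains. *)
Lemma same_image (M M' N : finType) (A : {set N}) (f : M -> N) (f' : M' -> N) :
    injective f -> injective f' ->
    (forall y, y \in A <-> exists m, y = f m) ->
    (forall y, y \in A <-> exists m, y = f' m) ->
  exists2 phi : M -> M', bijective phi & forall m, f' (phi m) = f m.
Proof.
move=> fi f'i imf imf'.
have ex m : exists m', f' m' = f m.
  by have /imf'[m' e] : f m \in A; [apply/imf; exists m | exists m'].
have ex' m' : exists m, f m = f' m'.
  by have /imf[m e] : f' m' \in A; [apply/imf'; exists m' | exists m].
have [phi phiE] := choice ex; have [psi psiE] := choice ex'.
exists phi => //; exists psi => m; first by apply: fi; rewrite psiE phiE.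
by apply: f'i; rewrite phiE psiE.
Qed.

Lemma preim_factor (M M' N : finType) (f : M -> N) (f' : M' -> N)
    (phi : M -> M') (s : {set N}) : bijective phi ->
  (forall m, f' (phi m) = f m) -> f' @^-1: s = phi @: (f @^-1: s).
Proof.
move=> [psi phiK psiK] e; apply/setP=> x; rewrite inE; apply/idP/imsetP.
  by move=> xs; exists (psi x); rewrite ?psiK // inE -e psiK.
by case=> y; rewrite inE -e => ys ->.
Qed.

Lemma restrHP (M N : finType) (H : {set {set N}}) (f : M -> N) k :
  reflect (exists s, [/\ s \in H, k = f @^-1: s & k != set0]) (k \in restrH H f).
Proof.
rewrite !inE; apply: (iffP andP) => [[k0 /imsetP[s sH e]]|[s [sH e k0]]].
  by exists s.
by split=> //; apply/imsetP; exists s.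
Qed.

Lemma restrH_factor (M M' N : finType) (H : {set {set N}}) (f : M -> N)
    (f' : M' -> N) (phi : M -> M') : bijective phi ->
  (forall m, f' (phi m) = f m) ->
  restrH H f' = [set phi @: s | s : {set M} in restrH H f].
Proof.
move=> bphi e; apply/setP=> k; apply/restrHP/imsetP.
  case=> s [sH ek k0]; exists (f @^-1: s); last by rewrite ek (preim_factor _ bphi e).
  apply/restrHP; exists s; split=> //; apply: contraNneq k0 => s0.
  by rewrite ek (preim_factor _ bphi e) s0 imset0.
case=> _ /restrHP[s [sH -> k0]] ->; exists s; split=> //.
  by rewrite (preim_factor _ bphi e).
by rewrite imset_eq0.
Qed.

Lemma preim_comp_imset (M N N' : finType) (f : M -> N) (th : N -> N') (s : {set N}) :
  injective th -> (th \o f) @^-1: (th @: s) = f @^-1: s.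
Proof. by move=> thi; apply/setP=> x; rewrite !inE /= mem_imset. Qed.

Lemma restrH_comp (M N N' : finType) (H : {set {set N}}) (f : M -> N) (th : N -> N') :
  injective th -> restrH [set th @: s | s : {set N} in H] (th \o f) = restrH H f.
Proof.
move=> thi; apply/setP=> k; apply/restrHP/restrHP=> -[s [sH -> k0]].
  case/imsetP: sH k0 => t tH -> k0; exists t; split=> //.
    by rewrite preim_comp_imset.
exists (th @: s); rewrite imset_f // preim_comp_imset //.
Qed.

Section Embeddings.
Variable d : nat.

(** [e] identifies the nodes of [S] with the set of nodes [A] of [T] and respects
    labels and edges. Hyperedges are ignored, so the index sets may differ. *)
Record node_emb J J' (S : lforest d J) (T : lforest d J')
    (A : {set 'I_(nnodes T)}) (e : 'I_(nnodes S) -> 'I_(nnodes T)) : Prop :=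
  NodeEmb {
    emb_inj : injective e;
    emb_im : forall y, y \in A <-> exists m, y = e m;
    emb_label : forall x, label (e x) = label x;
    emb_edge : forall x y, edge (edges T) (e x) (e y) = edge (edges S) x y
  }.

(** [S] is, via [f], the restriction of [T] to [A]: hyperedges are intersected
    with [A] and the empty untagged ones are dropped. *)
Record restricts J (S T : lforest d J) (A : {set 'I_(nnodes T)})
    (f : 'I_(nnodes S) -> 'I_(nnodes T)) : Prop := Restricts {
  restr_emb : node_emb A f;
  restr_tag : forall j, tagged S j = f @^-1: tagged T j;
  restr_hyper : hyper S = restrH (hyper T) f
}.

(** The upper forest of [p] is, via [g], the prune of [T] on the complement of
    [A], where [f] identifies the lower forest with the root part: a block that
    meets [A] becomes the hyperedge tagged by its trace on [A], the other blocks
    stay untagged. *)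
Record prunes J (T : lforest d J) (p : cpair d J) (A : {set 'I_(nnodes T)})
    (f : 'I_(nnodes (lower p)) -> 'I_(nnodes T))
    (g : 'I_(nnodes (upper p)) -> 'I_(nnodes T)) : Prop := Prunes {
  prune_emb : node_emb (~: A) g;
  prune_tagl : forall j, tagged (upper p) (inl j) = g @^-1: tagged T j;
  prune_tagr : forall (k : htag (lower p)) s, s \in hyper T ->
    val k = f @^-1: s -> tagged (upper p) (inr k) = g @^-1: s;
  prune_hyper : hyper (upper p) =
    restrH [set s : {set _} in hyper T | f @^-1: s == set0] g
}.

(** [p] is a representative of the pair (prune, root) of [T] along [A], up to
    the numbering of nodes. *)
Definition cut_along J (T : lforest d J) (A : {set 'I_(nnodes T)})
    (p : cpair d J) : Prop :=
  exists f g, restricts A f /\ @prunes J T p A f g.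

Lemma emb_uniq J J' K (S : lforest d J) (S' : lforest d J') (T : lforest d K)
    (A : {set 'I_(nnodes T)}) (e : 'I_(nnodes S) -> 'I_(nnodes T))
    (e' : 'I_(nnodes S') -> 'I_(nnodes T)) :
    node_emb A e -> node_emb A e' ->
  exists phi : 'I_(nnodes S) -> 'I_(nnodes S'),
    [/\ bijective phi, forall x, e' (phi x) = e x,
        forall x, label (phi x) = label x &
        forall x y, edge (edges S') (phi x) (phi y) = edge (edges S) x y].
Proof.
move=> [ei im el ee] [ei' im' el' ee'].
have [phi bphi phiE] := same_image ei ei' im im'.
exists phi; split=> // [x|x y]; first by rewrite -el' phiE el.
by rewrite -ee' !phiE ee.
Qed.

Lemma restricts_uniq J (S S' T : lforest d J) (A : {set 'I_(nnodes T)}) e e' :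
    @restricts J S T A e -> @restricts J S' T A e' ->
  exists2 phi, lf_iso eq (T := S) (T' := S') phi & forall x, e' (phi x) = e x.
Proof.
move=> [em tg hp] [em' tg' hp']; have [phi [bphi pE pl pe]] := emb_uniq em em'.
exists phi => //; split=> // [j _ <-|].
  by rewrite tg' (preim_factor _ bphi pE) -tg.
by rewrite hp' (restrH_factor _ bphi pE) -hp.
Qed.

Lemma restrictsP J (S T : lforest d J) A e (k : htag S) : @restricts J S T A e ->
  exists2 s, s \in hyper T & val k = e @^-1: s.
Proof.
move=> re; have kH : val k \in restrH (hyper T) e.
  by rewrite -(restr_hyper re); apply: (valP k).
by have /restrHP[s [sH ek _]] := kH; exists s.
Qed.

Lemma cut_along_uniq J (T : lforest d J) A p p' :
  @cut_along J T A p -> @cut_along J T A p' ->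
  p = p' %[mod CoupledPair d J].
Proof.
move=> [f [g [rf [em tl tr hp]]]] [f' [g' [rf' [em' tl' tr' hp']]]].
apply/eqmodP/asboolP; have [phi isof phiE] := restricts_uniq rf rf'.
have bphi := iso_bij isof.
have [psi [bpsi pE pl pe]] := emb_uniq em em'.
exists phi, psi; split=> //; split=> // [|].
  move=> [j|k] [j'|k'] //= => [<-|]; first by rewrite tl' (preim_factor _ bpsi pE) -tl.
  rewrite /htag_rel => ek; have [s sH es] := restrictsP k rf.
  rewrite (tr' _ s) //; last by rewrite ek es (preim_factor _ bphi phiE).
  by rewrite (preim_factor _ bpsi pE) -(tr k).
rewrite hp' (restrH_factor _ bpsi pE) hp; congr (imset _ (mem (restrH _ _))).
apply/setP=> s; rewrite !inE; congr (_ && _).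
by rewrite (preim_factor _ bphi phiE) imset_eq0.
Qed.

Lemma emb_isol J K K' (S : lforest d J) (T : lforest d K) (T' : lforest d K')
    A e rel th : lf_iso rel (T := T) (T' := T') th ->
  @node_emb J K S T A e -> node_emb (th @: A) (th \o e).
Proof.
move=> [bt tl te _ _] [ei im el ee]; have ti := bij_inj bt.
split=> [|y|x|x y] /=.
- exact: inj_comp.
- split=> [/imsetP[x /im[m ->] ->]|[m ->]]; first by exists m.
  by apply/imset_f/im; exists m.
- by rewrite tl el.
by rewrite te ee.
Qed.

Lemma emb_isor J J' K (S : lforest d J) (S' : lforest d J') (T : lforest d K)
    A e rel phi : lf_iso rel (T := S') (T' := S) phi ->
  @node_emb J K S T A e -> @node_emb J' K S' T A (e \o phi).
Proof.
move=> [bp pl pe _ _] [ei im el ee]; have [psi _ psiK] := bp.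
split=> [|y|x|x y] /=.
- exact: inj_comp (bij_inj bp).
- split=> [/im[m ->]|[m ->]]; last by apply/im; exists (phi m).
  by exists (psi m); rewrite psiK.
- by rewrite el pl.
by rewrite ee pe.
Qed.

Lemma restricts_isol J (S T T' : lforest d J) A e th :
    lf_iso eq (T := T) (T' := T') th ->
  @restricts J S T A e -> restricts (th @: A) (th \o e).
Proof.
move=> it [em tg hp]; have ti := bij_inj (iso_bij it).
split=> [|j|]; first exact: emb_isol it em.
  by rewrite (iso_tagged it (erefl j)) preim_comp_imset.
by rewrite (iso_hyper it) restrH_comp.
Qed.

Lemma restricts_isor J (S S' T : lforest d J) A e phi :
    lf_iso eq (T := S') (T' := S) phi ->
  @restricts J S T A e -> @restricts J S' T A (e \o phi).
Proof.
move=> ip [em tg hp]; have pi := bij_inj (iso_bij ip).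
have pE m : e (phi m) = (e \o phi) m by [].
split=> [|j|]; first exact: emb_isor ip em.
  apply: (imset_inj pi); rewrite -(iso_tagged ip (erefl j)) tg.
  exact: (preim_factor _ (iso_bij ip) pE).
apply: (imset_inj (imset_inj pi)); rewrite -(iso_hyper ip) hp.
exact: (restrH_factor _ (iso_bij ip) pE).
Qed.

Lemma cut_along_isol J (T T' : lforest d J) A p th :
  lf_iso eq (T := T) (T' := T') th -> @cut_along J T A p ->
  @cut_along J T' (th @: A) p.
Proof.
move=> it [f [g [rf [em tl tr hp]]]]; have ti := bij_inj (iso_bij it).
exists (th \o f), (th \o g); split; first exact: restricts_isol it rf.
split=> [|j|k s|].
- suff <- : th @: (~: A) = ~: (th @: A) by apply: emb_isol it em.
  have [ht thK htK] := iso_bij it; apply/setP=> x; rewrite -(htK x).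
  by rewrite inE !mem_imset // inE.
- by rewrite tl (iso_tagged it (erefl j)) preim_comp_imset.
- rewrite (iso_hyper it) => /imsetP[t tH ->]; rewrite !preim_comp_imset //.
  exact: tr.
rewrite hp -(restrH_comp _ g ti) (iso_hyper it).
apply: (congr1 (fun H => restrH H (th \o g))).
apply/setP=> s; rewrite !inE; apply/imsetP/andP => [[t]|[/imsetP[t tH ->]]].
  by rewrite inE => /andP[tH t0] ->; rewrite preim_comp_imset // imset_f.
by rewrite preim_comp_imset // => t0; exists t; rewrite // inE tH.
Qed.

Lemma cut_along_equiv J (T : lforest d J) A p p' : p = p' %[mod CoupledPair d J] ->
  @cut_along J T A p -> @cut_along J T A p'.
Proof.
move=> /esym/eqmodP/asboolP[phi [psi [ip iu]]] [f [g [rf [em tl tr hp]]]].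
have [pi ui] := (bij_inj (iso_bij ip), bij_inj (iso_bij iu)).
have fE m : f (phi m) = (f \o phi) m by [].
have gE m : g (psi m) = (g \o psi) m by [].
exists (f \o phi), (g \o psi); split; first exact: restricts_isor ip rf.
split=> [|j|k s sH es|]; first exact: emb_isor iu em.
- apply: (imset_inj ui).
  rewrite -(iso_tagged iu (erefl j : sum_rel eq (htag_rel phi) (inl j) (inl j))) tl.
  exact: (preim_factor _ (iso_bij iu) gE).
- have kH : phi @: val k \in hyper (lower p).
    by rewrite (iso_hyper ip) imset_f //; apply: (valP k).
  pose k' : htag (lower p) := exist (fun s => s \in hyper (lower p)) _ kH.
  apply: (imset_inj ui).
  rewrite -(iso_tagged iu (erefl : sum_rel eq (htag_rel phi) (inr k) (inr k'))).
  rewrite (tr k' s) //; first exact: (preim_factor _ (iso_bij iu) gE).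
  by rewrite /= es; apply/esym/(preim_factor _ (iso_bij ip) fE).
apply: (imset_inj (imset_inj ui)); rewrite -(iso_hyper iu) hp.
rewrite (restrH_factor _ (iso_bij iu) gE); congr (imset _ (mem (restrH _ _))).
apply/setP=> s; rewrite !inE; congr (_ && _).
by rewrite (preim_factor _ (iso_bij ip) fE) imset_eq0.
Qed.

Lemma cut_pair_along J (T : lforest d J) (c : forest_cut (edges T)) :
  cut_along (cut_root c) (cut_pair c).
Proof.
exists enum_val, enum_val; split; split=> //.
- split=> //; [exact: enum_val_inj|exact: cut_root_im|].
  by move=> x y; rewrite [in RHS]/edge inE.
- split=> //; first exact: enum_val_inj.
    by move=> y; rewrite inE; apply: cut_prune_im.
  by move=> x y; rewrite [in RHS]/edge inE.
move=> k s sH ek; apply/setP=> x; rewrite !inE.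
apply/existsP/idP => [[t /and3P[tH /eqP et xt]]|xs]; last first.
  by exists s; rewrite sH -ek eqxx.
have := valP k; rewrite ek => /restrHP[_ [_ _ /set0Pn[a sa]]].
have ta : a \in enum_val @^-1: t by rewrite et ek.
by rewrite !inE in sa ta xt *; rewrite (lions_block_inj (lforestP T) sH tH sa ta).
Qed.

(** The coupled pair (prune, root) of [T] along the upset [A]; it is meaningful
    for upsets only. *)
Definition cut_class J (T : lforest d J) (A : {set 'I_(nnodes T)}) : CoupledPair d J :=
  \pi_(CoupledPair d J) (cut_pair (upset_cut (edges T) A)).

Lemma cut_class_along J (T : lforest d J) A : upset (edges T) A ->
  cut_along A (repr (cut_class A)).
Proof.
move=> upA; apply: cut_along_equiv (_ : cut_pair (upset_cut (edges T) A) = _ %[mod _]) _.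
  by rewrite reprK.
by have := cut_pair_along (upset_cut (edges T) A);
  rewrite upset_cutK //; apply: lions_forest (lforestP T).
Qed.

Lemma cut_classE J (T : lforest d J) A p : upset (edges T) A -> cut_along A p ->
  \pi p = cut_class A.
Proof.
move=> upA cp; rewrite -[RHS]reprK.
exact: cut_along_uniq cp (cut_class_along upA).
Qed.

Lemma iso_upset J (T T' : lforest d J) rel th (A : {set 'I_(nnodes T)}) :
  lf_iso rel (T := T) (T' := T') th -> upset (edges T') (th @: A) = upset (edges T) A.
Proof.
move=> it; have [ht thK htK] := iso_bij it; have ti := can_inj thK.
apply/upsetP/upsetP=> up x y.
  by rewrite -(mem_imset _ _ ti) -(iso_edge it) -(mem_imset A y ti); apply: up.
by rewrite -(htK x) -(htK y) !mem_imset // (iso_edge it); apply: up.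
Qed.

End Embeddings.

(** * Rooting and tagging *)

Section RootingCuts.
Variable d : nat.

Lemma lift0F n (s : {set 'I_n}) : (ord0 \in lift ord0 @: s) = false.
Proof. by apply/negP=> /imsetP[x _ /eqP]; rewrite (negbTE (neq_lift _ _)). Qed.

Lemma mem_lift0 n (s : {set 'I_n}) a : (lift ord0 a \in lift ord0 @: s) = (a \in s).
Proof. exact: mem_imset (@lift_inj _ _). Qed.

(** The extension of [f] to a new least element, which is the new root of a
    rooted forest. *)
Definition rlift m n (f : 'I_m -> 'I_n) (x : 'I_m.+1) : 'I_n.+1 :=
  if unlift ord0 x is Some a then lift ord0 (f a) else ord0.

Lemma rlift_lift m n (f : 'I_m -> 'I_n) a : rlift f (lift ord0 a) = lift ord0 (f a).
Proof. by rewrite /rlift liftK. Qed.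

Lemma rlift0 m n (f : 'I_m -> 'I_n) : rlift f ord0 = ord0.
Proof. by rewrite /rlift unlift_none. Qed.

Lemma rlift_preim m n (f : 'I_m -> 'I_n) (s : {set 'I_n}) :
  rlift f @^-1: (lift ord0 @: s) = lift ord0 @: (f @^-1: s).
Proof.
apply/setP=> x; rewrite inE; case: (unliftP ord0 x) => [a ->|->].
  by rewrite rlift_lift !mem_lift0 inE.
by rewrite rlift0 !lift0F.
Qed.

Lemma rlift_preim0 m n (f : 'I_m -> 'I_n) (s : {set 'I_n}) :
  rlift f @^-1: (ord0 |: lift ord0 @: s) = ord0 |: lift ord0 @: (f @^-1: s).
Proof.
rewrite preimsetU rlift_preim; congr (_ :|: _); apply/setP=> x; rewrite !inE.
case: (unliftP ord0 x) => [a ->|->]; last by rewrite rlift0.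
by rewrite rlift_lift !(eq_sym _ ord0) !(negbTE (neq_lift _ _)).
Qed.

Lemma rooting_edge_root n (E : {set 'I_n * 'I_n}) a :
  edge (rootE E) (lift ord0 a) ord0 = is_root E a.
Proof.
apply/idP/idP=> [/rooting_edge[[b [c [_ /eqP]]]|[b [/lift_inj-> _]]] //|ra].
by apply/rooting_edge; right; exists a.
Qed.

Lemma rooting_edge0 n (E : {set 'I_n * 'I_n}) x : edge (rootE E) ord0 x = false.
Proof. by apply/negP; have /forallP/(_ x)/negP := rooting_root0 E. Qed.

(** A node of an upset is a root of the restriction iff it is a root of the
    forest. *)
Lemma emb_root J J' (S : lforest d J) (T : lforest d J') A e :
  upset (edges T) A -> @node_emb d J J' S T A e ->
  forall x, is_root (edges T) (e x) = is_root (edges S) x.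
Proof.
move=> /upsetP upA em x; apply/forallP/forallP=> nr y; apply/negP.
  by rewrite -(emb_edge em); apply/negP.
move=> xy; have /(emb_im em)[z ez] : y \in A.
  by apply: upA xy; apply/(emb_im em); exists x.
by move/negP: (nr z); apply; rewrite -(emb_edge em) -ez.
Qed.

Lemma rooting_upset n (E : {set 'I_n * 'I_n}) (A : {set 'I_n}) :
  upset (rootE E) (ord0 |: lift ord0 @: A) = upset E A.
Proof.
apply/upsetP/upsetP=> up x y.
  move=> xA xy; move: (up (lift ord0 x) (lift ord0 y)).
  rewrite rooting_edge_up !in_setU1 !mem_lift0 !(eq_sym _ ord0).
  by rewrite !(negbTE (neq_lift _ _)); apply.
move=> xA /rooting_edge[[a [b [ex -> ab]]]|[a [_ -> _]]]; last by rewrite !inE eqxx.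
move: xA; rewrite ex !in_setU1 !mem_lift0 !(eq_sym _ ord0) !(negbTE (neq_lift _ _)).
by move=> /= aA; apply: up ab.
Qed.

Lemma rooting_upset_cases n (E : {set 'I_n * 'I_n}) (B : {set 'I_n.+1}) :
    directed_forest E -> upset (rootE E) B ->
  B = set0 \/ B = ord0 |: lift ord0 @: (lift ord0 @^-1: B).
Proof.
move=> fE /upsetP upB; case: (boolP (ord0 \in B)) => B0; [right|left].
  apply/setP=> x; rewrite in_setU1; case: (unliftP ord0 x) => [a ->|->].
    by rewrite mem_lift0 inE eq_sym (negbTE (neq_lift _ _)).
  by rewrite B0 eqxx.
apply/setP=> x; rewrite in_set0; apply: contraNF B0.
case: (unliftP ord0 x) => [a ->|-> //].
have [m] := ubnP (depth E a); elim: m a => // m IHm a lt_am aB.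
case: (boolP (is_root E a)) => [ra|/rootPn[b ab]].
  by apply: upB aB _; rewrite rooting_edge_root.
apply: (IHm b); last by apply: upB aB _; rewrite rooting_edge_up.
by move: lt_am; rewrite (depth_edge fE ab).
Qed.

Lemma sum_rooting_upsets (V : zmodType) n (E : {set 'I_n * 'I_n})
    (F : {set 'I_n.+1} -> V) : directed_forest E ->
  \sum_(B | upset (rootE E) B) F B =
  F set0 + \sum_(A | upset E A) F (ord0 |: lift ord0 @: A).
Proof.
move=> fE; rewrite (bigD1 set0) /=; last by apply/upsetP=> x y; rewrite inE.
congr (_ + _).
rewrite (reindex_onto (fun A : {set 'I_n} => ord0 |: lift ord0 @: A)
  (fun B => lift ord0 @^-1: B)) /=.
  apply: eq_bigl => A; rewrite rooting_upset.
  have -> : lift ord0 @^-1: (ord0 |: lift ord0 @: A) = A.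
    by apply/setP=> x; rewrite inE in_setU1 mem_lift0 eq_sym (negbTE (neq_lift _ _)).
  rewrite eqxx andbT; case: (upset E A) => //=.
  by apply/set0Pn; exists ord0; rewrite !inE eqxx.
by move=> B /andP[/(rooting_upset_cases fE)[->|<-]] //; rewrite eqxx.
Qed.

Lemma rlift_restrH m n (f : 'I_m -> 'I_n) (H : {set {set 'I_n}}) :
  restrH (rootH H) (rlift f) = rootH (restrH H f).
Proof.
apply/setP=> k; apply/restrHP/imsetP.
  case=> _ [/imsetP[s sH ->]]; rewrite rlift_preim => -> k0.
  exists (f @^-1: s) => //; apply/restrHP; exists s; split=> //.
  by apply: contraNneq k0 => ->; rewrite imset0.
case=> _ /restrHP[s [sH -> k0]] ->; exists (lift ord0 @: s).
by rewrite rlift_preim imset_eq0 k0; split=> //; apply: imset_f.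
Qed.

Lemma rooting_along (i : 'I_d) (T : lforest d unit) (A : {set 'I_(nnodes T)}) p :
    upset (edges T) A -> cut_along A p ->
  @cut_along d unit (lf_rooting i T) (ord0 |: lift ord0 @: A) (cp_rooting i p).
Proof.
move=> upA [f [g [[emf tf hf] [emg tl tr hp]]]].
have li n := @lift_inj n.+1 ord0.
exists (rlift f), (fun x => lift ord0 (g x)); split; split.
- split.
  + move=> x y; case: (unliftP ord0 x) => [a ->|->];
    case: (unliftP ord0 y) => [b ->|->]; rewrite ?rlift_lift ?rlift0 //.
    by move/li/(emb_inj emf)->.
  + move=> y; rewrite in_setU1; case: (unliftP ord0 y) => [b ->|->]; last first.
      by split=> // _; exists ord0; rewrite rlift0.
    rewrite mem_lift0 eq_sym (negbTE (neq_lift _ _)) /=.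
    split=> [/(emb_im emf)[a ->]|[x]]; first by exists (lift ord0 a); rewrite rlift_lift.
    case: (unliftP ord0 x) => [a ->|->]; rewrite ?rlift_lift ?rlift0.
      by move/li=> ->; apply/(emb_im emf); exists a.
    by move/eqP; rewrite eq_sym (negbTE (neq_lift _ _)).
  + move=> x /=; case: (unliftP ord0 x) => [a ->|->]; rewrite ?rlift_lift ?rlift0.
      by rewrite !liftK (emb_label emf).
    by rewrite !unlift_none.
  + move=> x y /=; case: (unliftP ord0 x) => [a ->|->];
    case: (unliftP ord0 y) => [b ->|->]; rewrite ?rlift_lift ?rlift0.
    * by rewrite !rooting_edge_up (emb_edge emf).
    * by rewrite !rooting_edge_root (emb_root upA emf).
    * by rewrite !rooting_edge0.
    * by rewrite !rooting_edge0.
- by case; rewrite /= /rooth tf rlift_preim0.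
- by rewrite /= rlift_restrH hf.
- split=> [x y /li /(emb_inj emg) //|y|x|x y] /=.
  + rewrite in_setC in_setU1; case: (unliftP ord0 y) => [b ->|->]; last first.
      rewrite eqxx; split=> // -[x /eqP]; by rewrite (negbTE (neq_lift _ _)).
    rewrite mem_lift0 eq_sym (negbTE (neq_lift _ _)) /= -in_setC.
    by split=> [/(emb_im emg)[a ->]|[a /li->]]; [exists a | apply/(emb_im emg); exists a].
  + by rewrite liftK (emb_label emg).
  + by rewrite rooting_edge_up (emb_edge emg).
- case=> /=; rewrite
    (retaghE _ (sum_map_inj (@inj_id unit) (@htag_lift_inj d i (lower p))) (inl tt)).
  rewrite tl; apply/setP=> x.
  by rewrite !inE mem_lift0 eq_sym (negbTE (neq_lift _ _)).
- move=> k s /imsetP[t tH ->]; rewrite rlift_preim.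
  have [k0 kH ek] := imsetP (valP k); rewrite ek => /(imset_inj (@li _)) ek0.
  have -> : k = htag_lift i (exist (fun s => s \in hyper (lower p)) _ kH).
    exact: val_inj.
  rewrite /=
    (retaghE _ (sum_map_inj (@inj_id unit) (@htag_lift_inj d i (lower p))) (inr _)).
  rewrite (tr _ t) //; apply/setP=> x; by rewrite !inE mem_lift0.
rewrite /= hp -(restrH_comp _ g (@li _)).
apply: (congr1 (fun H => restrH H (lift ord0 \o g))).
apply/setP=> s; rewrite !inE; apply/imsetP/andP => [[t]|[/imsetP[t tH ->]]].
  rewrite inE => /andP[tH /eqP t0] ->.
  by rewrite rlift_preim t0 imset0 eqxx; split=> //; apply: imset_f.
by rewrite rlift_preim imset_eq0 => t0; exists t; rewrite // inE tH.
Qed.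

(** The empty upset corresponds to cutting off the whole forest. *)
Lemma with_one_along J (T : lforest d J) : @cut_along d J T set0 (cp_with_one T).
Proof.
exists (fun x : 'I_0 => match notF (ltn_ord x) with end), id; split; split.
- split=> [[]|y|[]|[]] //; rewrite inE; by split=> // -[[]].
- by move=> j; apply/setP=> -[].
- apply/setP=> s; rewrite inE; apply/esym/negP=> /restrHP[t [_ _ /set0Pn[[]]]] //.
- split=> // y; rewrite !inE; split=> // _; by exists y.
- move=> j /=; rewrite (retaghE _ (@inl_inj J (htag (lf_empty d J)))).
  by apply/setP=> x; rewrite inE.
- by move=> [k kH]; exfalso; move: kH; rewrite inE.
apply/setP=> s /=; apply/idP/restrHP => [sH|[t [+ -> _]]].
  exists s; rewrite !inE sH /=; split.
  - by apply/eqP/setP=> -[].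
  - by apply/setP=> x; rewrite inE.
  by apply: contraNneq (lions_set0 (lforestP T)) => <-.
by rewrite inE => /andP[tH _]; rewrite (_ : id @^-1: t = t) //; apply/setP=> x; rewrite inE.
Qed.

Lemma tag_along I (iota : I) (T : lforest d unit) (A : {set 'I_(nnodes T)}) p :
  cut_along A p -> @cut_along d I (lf_tag iota T) A (cp_tag iota p).
Proof.
move=> [f [g [[emf tf hf] [emg tl tr hp]]]]; exists f, g; split; split=> //.
- by case: emf; split.
- move=> j /=; apply/setP=> x; rewrite !inE.
  by apply: asbool_equiv_eq; split=> -[[] e xt]; exists tt => //; move: xt; rewrite tf inE.
- by case: emg; split.
- move=> j /=; apply/setP=> x; rewrite !inE; apply: asbool_equiv_eq; split.
    by case=> -[[]|k] //= [<-]; rewrite tl inE; exists tt.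
  by case=> -[] <- xt; exists (inl tt); rewrite // tl inE.
move=> k s sH ek /=.
rewrite (retaghE _ (sum_map_inj (@const_unit_inj _ iota) (@inj_id (htag (lower p)))) (inr k)).
exact: tr.
Qed.

End RootingCuts.

(** * Products *)

Section ProductCuts.

Lemma lshift_memr m n (s : {set 'I_n}) (a : 'I_m) :
  (lshift n a \in @rshift m n @: s) = false.
Proof. by apply/negP=> /imsetP[b _ /shift_neq]. Qed.

Lemma rshift_meml m n (s : {set 'I_m}) (b : 'I_n) :
  (rshift m b \in @lshift m n @: s) = false.
Proof. by apply/negP=> /imsetP[a _ /esym/shift_neq]. Qed.

Lemma lshift_mem m n (s : {set 'I_m}) a : (lshift n a \in @lshift m n @: s) = (a \in s).
Proof. exact: mem_imset (@lshift_inj _ _). Qed.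

Lemma rshift_mem m n (s : {set 'I_n}) b : (rshift m b \in @rshift m n @: s) = (b \in s).
Proof. exact: mem_imset (@rshift_inj _ _). Qed.

Definition shift_mem := (lshift_memr, rshift_meml, lshift_mem, rshift_mem).

(** The set of nodes of a product with parts [A] and [B] in the two factors. *)
Definition shift_union m n (A : {set 'I_m}) (B : {set 'I_n}) : {set 'I_(m + n)} :=
  @lshift m n @: A :|: @rshift m n @: B.

Lemma lshift_union m n (A : {set 'I_m}) (B : {set 'I_n}) a :
  (lshift n a \in shift_union A B) = (a \in A).
Proof. by rewrite inE !shift_mem orbF. Qed.

Lemma rshift_union m n (A : {set 'I_m}) (B : {set 'I_n}) b :
  (rshift m b \in shift_union A B) = (b \in B).
Proof. by rewrite inE !shift_mem. Qed.

Section ShiftEdges.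
Variables (m n : nat) (E1 : {set 'I_m * 'I_m}) (E2 : {set 'I_n * 'I_n}).
Notation E := (prodE (@lshift m n) (@rshift m n) E1 E2).

Lemma edge_ll a b : edge E (lshift n a) (lshift n b) = edge E1 a b.
Proof.
apply/idP/idP=> [|ab].
  by case/(prod_edge1 (@lshift_inj _ _) (@shift_neq _ _)) => c /lshift_inj->.
by apply/(prod_edge1 (@lshift_inj _ _) (@shift_neq _ _)); exists b.
Qed.

Lemma edge_rr a b : edge E (rshift m a) (rshift m b) = edge E2 a b.
Proof.
apply/idP/idP=> [|ab].
  by case/(prod_edge2 (@rshift_inj _ _) (@shift_neq _ _)) => c /rshift_inj->.
by apply/(prod_edge2 (@rshift_inj _ _) (@shift_neq _ _)); exists b.
Qed.

Lemma edge_lr a b : edge E (lshift n a) (rshift m b) = false.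
Proof.
apply/negP.
by case/(prod_edge1 (@lshift_inj _ _) (@shift_neq _ _)) => c /esym/shift_neq.
Qed.

Lemma edge_rl a b : edge E (rshift m a) (lshift n b) = false.
Proof.
by apply/negP; case/(prod_edge2 (@rshift_inj _ _) (@shift_neq _ _)) => c /shift_neq.
Qed.

Definition edge_shift := (edge_ll, edge_rr, edge_lr, edge_rl).

Lemma shift_union_upset A B : upset E (shift_union A B) = upset E1 A && upset E2 B.
Proof.
apply/upsetP/andP=> [up|[/upsetP upA /upsetP upB] x y].
  split; apply/upsetP=> x y.
    by rewrite -(lshift_union A B x) -(lshift_union A B y) -edge_ll; apply: up.
  by rewrite -(rshift_union A B x) -(rshift_union A B y) -edge_rr; apply: up.
by case: (split_ordP x) => a ->; case: (split_ordP y) => b ->;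
  rewrite ?edge_shift ?lshift_union ?rshift_union //; [apply: upA|apply: upB].
Qed.

Lemma sum_prod_upsets (V : zmodType) (F : {set 'I_(m + n)} -> V) :
  \sum_(C | upset E C) F C =
  \sum_(A | upset E1 A) \sum_(B | upset E2 B) F (shift_union A B).
Proof.
rewrite pair_big /= (reindex_onto
  (fun AB : {set 'I_m} * {set 'I_n} => shift_union AB.1 AB.2)
  (fun C => (@lshift m n @^-1: C, @rshift m n @^-1: C))) /=.
  apply: eq_bigl => -[A B] /=; rewrite shift_union_upset.
  rewrite -[RHS]andbT; congr (_ && _); apply/eqP; congr (_, _); apply/setP=> x.
    by rewrite inE lshift_union.
  by rewrite inE rshift_union.
move=> C _; apply/setP=> x; case: (split_ordP x) => a ->.
  by rewrite lshift_union inE.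
by rewrite rshift_union inE.
Qed.

End ShiftEdges.

(** The map between disjoint unions given by maps of the two summands. *)
Definition osum m1 m2 n1 n2 (f1 : 'I_m1 -> 'I_n1) (f2 : 'I_m2 -> 'I_n2)
    (z : 'I_(m1 + m2)) : 'I_(n1 + n2) :=
  match split z with inl a => lshift n2 (f1 a) | inr b => rshift n1 (f2 b) end.

Section Osum.
Variables (m1 m2 n1 n2 : nat) (f1 : 'I_m1 -> 'I_n1) (f2 : 'I_m2 -> 'I_n2).

Lemma split_lshift m n (a : 'I_m) : split (lshift n a) = inl a.
Proof. exact: (unsplitK (inl a)). Qed.

Lemma split_rshift m n (b : 'I_n) : split (rshift m b) = inr b.
Proof. exact: (unsplitK (inr b)). Qed.

Lemma osuml a : osum f1 f2 (lshift m2 a) = lshift n2 (f1 a).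
Proof. by rewrite /osum split_lshift. Qed.

Lemma osumr b : osum f1 f2 (rshift m1 b) = rshift n1 (f2 b).
Proof. by rewrite /osum split_rshift. Qed.

Definition osumE := (osuml, osumr).

Lemma osum_inj : injective f1 -> injective f2 -> injective (osum f1 f2).
Proof.
move=> i1 i2 x y; case: (split_ordP x) => a ->; case: (split_ordP y) => b ->;
  rewrite !osumE.
- by move/lshift_inj/i1->.
- by move/shift_neq.
- by move/esym/shift_neq.
by move/rshift_inj/i2->.
Qed.

Lemma osum_preiml (s : {set 'I_n1}) : osum f1 f2 @^-1: (@lshift n1 n2 @: s) =
  @lshift m1 m2 @: (f1 @^-1: s).
Proof.
by apply/setP=> x; rewrite inE; case: (split_ordP x) => a ->;
  rewrite osumE !shift_mem ?inE.
Qed.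

Lemma osum_preimr (s : {set 'I_n2}) : osum f1 f2 @^-1: (@rshift n1 n2 @: s) =
  @rshift m1 m2 @: (f2 @^-1: s).
Proof.
by apply/setP=> x; rewrite inE; case: (split_ordP x) => a ->;
  rewrite osumE !shift_mem ?inE.
Qed.

Lemma osum_restrH H1 H2 :
  restrH (prodH (@lshift n1 n2) (@rshift n1 n2) H1 H2) (osum f1 f2) =
  prodH (@lshift m1 m2) (@rshift m1 m2) (restrH H1 f1) (restrH H2 f2).
Proof.
apply/setP=> k; apply/restrHP/setUP => [[s [/setUP[]/imsetP[t tH ->] ->]]|].
- rewrite osum_preiml imset_eq0 => k0; left; apply: imset_f.
  by apply/restrHP; exists t.
- rewrite osum_preimr imset_eq0 => k0; right; apply: imset_f.
  by apply/restrHP; exists t.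
case=> /imsetP[_ /restrHP[s [sH -> k0]] ->].
  exists (@lshift n1 n2 @: s); rewrite osum_preiml imset_eq0; split=> //.
  by apply/setUP; left; apply: imset_f.
exists (@rshift n1 n2 @: s); rewrite osum_preimr imset_eq0; split=> //.
by apply/setUP; right; apply: imset_f.
Qed.

Lemma osum_imsetl (s : {set 'I_m1}) :
  osum f1 f2 @: (@lshift m1 m2 @: s) = @lshift n1 n2 @: (f1 @: s).
Proof. by rewrite -!imset_comp; apply: eq_imset => x /=; rewrite osumE. Qed.

Lemma osum_imsetr (s : {set 'I_m2}) :
  osum f1 f2 @: (@rshift m1 m2 @: s) = @rshift n1 n2 @: (f2 @: s).
Proof. by rewrite -!imset_comp; apply: eq_imset => x /=; rewrite osumE. Qed.

End Osum.

Variable d : nat.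

Lemma osum_bij m1 m2 n1 n2 (f1 : 'I_m1 -> 'I_n1) (f2 : 'I_m2 -> 'I_n2) :
  bijective f1 -> bijective f2 -> bijective (osum f1 f2).
Proof.
move=> [g1 fK1 gK1] [g2 fK2 gK2]; exists (osum g1 g2) => x;
by case: (split_ordP x) => a ->; rewrite !osumE ?fK1 ?fK2 ?gK1 ?gK2.
Qed.

Lemma prod_iso J J' (rel : J -> J' -> Prop) (U1 U2 : lforest d J)
    (V1 V2 : lforest d J') g1 g2 :
    lf_iso rel (T := U1) (T' := V1) g1 -> lf_iso rel (T := U2) (T' := V2) g2 ->
  lf_iso rel (T := lf_prod U1 U2) (T' := lf_prod V1 V2) (osum g1 g2).
Proof.
move=> i1 i2; split.
- exact: osum_bij (iso_bij i1) (iso_bij i2).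
- move=> x /=; case: (split_ordP x) => a ->; rewrite osumE.
    by rewrite !split_lshift (iso_label i1).
  by rewrite !split_rshift (iso_label i2).
- move=> x y /=; case: (split_ordP x) => a ->; case: (split_ordP y) => b ->;
  by rewrite !osumE !edge_shift ?(iso_edge i1) ?(iso_edge i2).
- move=> j j' jj; rewrite /= /prodh (iso_tagged i1 jj) (iso_tagged i2 jj).
  by rewrite imsetU osum_imsetl osum_imsetr.
rewrite /= /prodH (iso_hyper i1) (iso_hyper i2) imsetU -!imset_comp.
by congr (_ :|: _); apply: eq_imset => s /=; rewrite ?osum_imsetl ?osum_imsetr.
Qed.

Lemma retag_iso J J' K K' (rel : J -> J' -> Prop) (rel' : K -> K' -> Prop)
    (g : J -> K) (gi : injective g) (g' : J' -> K') (g'i : injective g')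
    (T : lforest d J) (T' : lforest d J') f :
    (forall k k', rel' k k' ->
       exists j j', [/\ k = g j, k' = g' j' & rel j j']) ->
    lf_iso rel (T := T) (T' := T') f ->
  lf_iso rel' (T := retag gi T) (T' := retag g'i T') f.
Proof.
move=> relP [bf lf ef tf hf]; split=> // k k' /relP[j [j' [-> -> jj]]] /=.
by rewrite (retaghE _ gi) (retaghE _ g'i); apply: tf.
Qed.

Lemma htag_prod_surj I (Y1 Y2 : lforest d I) (k : htag (lf_prod Y1 Y2)) :
  exists k0, k = htag_prod k0.
Proof.
case: k => k kH; case/setUP: (kH) => /imsetP[s sH es].
  exists (inl (exist (fun s => s \in hyper Y1) s sH)); exact: val_inj.
exists (inr (exist (fun s => s \in hyper Y2) s sH)); exact: val_inj.
Qed.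

Lemma htag_nonempty J (Y : lforest d J) (k : htag Y) : exists x, x \in val k.
Proof.
by apply/set0Pn; apply: contraNneq (lions_set0 (lforestP Y)) => <-; apply: (valP k).
Qed.

Lemma retagh_out J K (N : finType) (h : J -> {set N}) (g : J -> K) k :
  (forall j, g j <> k) -> retagh h g k = set0.
Proof.
by move=> gk; apply/setP=> x; rewrite !inE; apply/asboolP=> -[j /gk].
Qed.

Lemma retag_emb J K J' (g : J -> K) (gi : injective g) (S : lforest d J)
    (T : lforest d J') A e :
  @node_emb d J J' S T A e -> @node_emb d K J' (retag gi S) T A e.
Proof. by case; split. Qed.

Lemma htag_prod_rel I (Y1 Y2 Z1 Z2 : lforest d I) f1 f2
    (k : htag Y1 + htag Y2) (l : htag Z1 + htag Z2) :
    injective f1 -> injective f2 ->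
    htag_rel (Y := lf_prod Y1 Y2) (Y' := lf_prod Z1 Z2) (osum f1 f2)
      (htag_prod k) (htag_prod l) ->
  sum_rel (htag_rel f1) (htag_rel f2) k l.
Proof.
move=> i1 i2; rewrite /htag_rel /=.
case: k l => [k|k] [l|l] /=; rewrite ?osum_imsetl ?osum_imsetr.
- by move/(imset_inj (@lshift_inj _ _)).
- move=> e; have [x] := htag_nonempty l.
  have /setP/(_ (rshift (nnodes Z1) x)) := e; rewrite !shift_mem => xl.
  by rewrite (xl : (x \in val l) = false).
- move=> e; have [x] := htag_nonempty l.
  have /setP/(_ (lshift (nnodes Z2) x)) := e; rewrite !shift_mem => xl.
  by rewrite (xl : (x \in val l) = false).
by move/(imset_inj (@rshift_inj _ _)).
Qed.

Lemma cp_prod_equiv I (P P' : cpair2 d I) : P = P' %[mod CoupledPair2 d I] ->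
  cp_prod P = cp_prod P' %[mod CoupledPair d I].
Proof.
move=> /eqmodP/asboolP[f1 [f2 [g1 [g2 /= [if1 if2 ig1 ig2]]]]].
apply/eqmodP/asboolP; exists (osum f1 f2), (osum g1 g2); split.
  exact: prod_iso.
apply: retag_iso (prod_iso ig1 ig2).
move=> [j|k] [j'|k'] //= => [<-|kk]; first by exists (inl j), (inl j).
have [k0 ek] := htag_prod_surj k; have [k0' ek'] := htag_prod_surj k'.
exists (inr k0), (inr k0'); split; rewrite /= ?ek ?ek' //.
apply: htag_prod_rel; [exact: bij_inj (iso_bij if1)|exact: bij_inj (iso_bij if2)|].
by rewrite -ek -ek'.
Qed.

Lemma osum_emb J1 J2 K (S1 : lforest d J1) (S2 : lforest d J1)
    (T1 T2 : lforest d J2) A1 A2 e1 e2 :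
    @node_emb d J1 J2 S1 T1 A1 e1 -> @node_emb d J1 J2 S2 T2 A2 e2 ->
  forall (g : J1 -> K) (gi : injective g),
  @node_emb d K J2 (retag gi (lf_prod S1 S2)) (lf_prod T1 T2) (shift_union A1 A2)
    (osum e1 e2).
Proof.
move=> [i1 m1 l1 ed1] [i2 m2 l2 ed2] g gi; split.
- exact: osum_inj.
- move=> y; case: (split_ordP y) => a ->; rewrite ?lshift_union ?rshift_union; split.
  + by move/m1=> [x ->]; exists (lshift _ x); rewrite osumE.
  + case=> x; case: (split_ordP x) => b ->; rewrite osumE; last by move/shift_neq.
    by move/lshift_inj=> e; apply/m1; exists b.
  + by move/m2=> [x ->]; exists (rshift _ x); rewrite osumE.
  + case=> x; case: (split_ordP x) => b ->; rewrite osumE; first by move/esym/shift_neq.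
    by move/rshift_inj=> e; apply/m2; exists b.
- move=> x /=; case: (split_ordP x) => a ->; rewrite osumE ?split_lshift ?split_rshift.
    exact: l1.
  exact: l2.
move=> x y /=; case: (split_ordP x) => a ->; case: (split_ordP y) => b ->;
by rewrite !osumE !edge_shift ?ed1 ?ed2.
Qed.

Lemma shift_unionC m n (A : {set 'I_m}) (B : {set 'I_n}) :
  ~: shift_union A B = shift_union (~: A) (~: B).
Proof.
by apply/setP=> x; rewrite inE; case: (split_ordP x) => a ->;
  rewrite ?lshift_union ?rshift_union inE.
Qed.

Lemma prod_along I (T1 T2 : lforest d I) A1 A2 p1 p2 :
    @cut_along d I T1 A1 p1 -> @cut_along d I T2 A2 p2 ->
  @cut_along d I (lf_prod T1 T2) (shift_union A1 A2) (cp_prod (cp_twist p1 p2)).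
Proof.
move=> [f1 [g1 [[emf1 tf1 hf1] [emg1 tl1 tr1 hp1]]]].
move=> [f2 [g2 [[emf2 tf2 hf2] [emg2 tl2 tr2 hp2]]]].
exists (osum f1 f2), (osum g1 g2); split; split.
- by have [] := osum_emb emf1 emf2 (@inj_id I); split.
- by move=> j; rewrite /= /prodh tf1 tf2 preimsetU osum_preiml osum_preimr.
- by rewrite /= osum_restrH hf1 hf2.
- rewrite shift_unionC.
  exact: osum_emb (retag_emb _ emg1) (retag_emb _ emg2) _ _.
- move=> j /=.
  rewrite (retaghE _ (sum_map_inj (@inj_id I) (@htag_prod_inj d I _ _)) (inl j)).
  rewrite /prodh.
  rewrite (retaghE _ (sum_map_inj (@inj_id I)
    (@inl_inj (htag (lower p1)) (htag (lower p2)))) (inl j)).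
  rewrite (retaghE _ (sum_map_inj (@inj_id I)
    (@inr_inj (htag (lower p1)) (htag (lower p2)))) (inl j)).
  by rewrite tl1 tl2 preimsetU osum_preiml osum_preimr.
- move=> k s sH; have [k0 ->] := htag_prod_surj k; rewrite [LHS]/= => ek.
  rewrite [LHS](retaghE _ (sum_map_inj (@inj_id I) (@htag_prod_inj d I _ _)) (inr k0)).
  rewrite /= /prodh; case/setUP: sH ek => /imsetP[t tH ->];
    rewrite ?osum_preiml ?osum_preimr; case: k0 => k0 ek.
  + rewrite (retaghE _ (sum_map_inj (@inj_id I) (@inl_inj _ _)) (inr k0)).
    rewrite retagh_out ?imset0 ?setU0; last by case.
    by rewrite (tr1 k0 t tH (imset_inj (@lshift_inj _ _) ek)).
  + have [x] := htag_nonempty k0.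
    have /setP/(_ (rshift (nnodes (lower p1)) x)) := ek; rewrite !shift_mem => xk.
    by rewrite (xk : (x \in val k0) = false).
  + have [x] := htag_nonempty k0.
    have /setP/(_ (lshift (nnodes (lower p2)) x)) := ek; rewrite !shift_mem => xk.
    by rewrite (xk : (x \in val k0) = false).
  rewrite (retaghE _ (sum_map_inj (@inj_id I) (@inr_inj _ _)) (inr k0)).
  rewrite retagh_out ?imset0 ?set0U; last by case.
  by rewrite (tr2 k0 t tH (imset_inj (@rshift_inj _ _) ek)).
rewrite /= hp1 hp2 -osum_restrH.
apply: (congr1 (fun H => restrH H (osum g1 g2))).
apply/setP=> s; apply/setUP/setIdP.
  case=> /imsetP[t]; rewrite inE => /andP[tH /eqP t0] ->.
    rewrite osum_preiml t0 imset0 eqxx; split=> //.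
    by apply/setUP; left; apply: imset_f.
  rewrite osum_preimr t0 imset0 eqxx; split=> //.
  by apply/setUP; right; apply: imset_f.
case=> /setUP[]/imsetP[t tH ->].
  rewrite osum_preiml imset_eq0 => t0; left; apply: imset_f.
  by rewrite inE tH.
rewrite osum_preimr imset_eq0 => t0; right; apply: imset_f.
by rewrite inE tH.
Qed.

End ProductCuts.

(** * Free modules *)

Section SpanTheory.
Variable R : pzRingType.

Lemma linext_basis (S : choiceType) (M : lmodType R) (f : S -> M) s :
  linext f (basis R s) = f s.
Proof.
rewrite (linextEw f (msuppU_le : msupp (basis R s) `<=` _)%fset).
by rewrite big_seq_fset1 mcoeffUU scale1r.
Qed.

Lemma singleE (S : choiceType) a (s : S) : single a s = a *: basis R s.
Proof. by apply/malgP=> t; rewrite span_scaleE !mcoeffU mulrnAr mulr1. Qed.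

Lemma linear_basis_ext (S : choiceType) (M : lmodType R)
    (D D' : {linear fspan R S -> M}) :
  (forall s, D (basis R s) = D' (basis R s)) -> D =1 D'.
Proof.
move=> eD u.
have -> : u = \sum_(s <- msupp u) u@_s *: basis R s.
  by rewrite {1}[u]monalgE; apply: eq_bigr => s _; rewrite -singleE.
rewrite !linear_sum; apply: eq_bigr => s _; by rewrite !linearZ eD.
Qed.

(** On a basis element the tensor product of operators depends only on their
    values at the two components, in a bilinear way. *)
Lemma tensor_mapE (S1 S2 S1' S2' : choiceType) (D1 : fspan R S1 -> fspan R S1')
    (D2 : fspan R S2 -> fspan R S2') s1 s2 :
  tensor_map D1 D2 (basis R (s1, s2)) =
  linext (fun p1 => linext (fun p2 => basis R (p1, p2)) (D2 (basis R s2)))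
    (D1 (basis R s1)).
Proof.
rewrite /tensor_map linext_basis /=; apply: eq_bigr => p1 _.
rewrite scaler_sumr; apply: eq_bigr => p2 _.
by rewrite singleE scalerA.
Qed.

End SpanTheory.

(** * The operator as a sum over upsets *)

Section DeltaCuts.
Variables (R : pzRingType) (d : nat).

Lemma eqmod_iso J (T T' : lforest d J) : T = T' %[mod Forest d J] ->
  exists f, lf_iso eq (T := T) (T' := T') f.
Proof. by move/eqmodP/asboolP. Qed.

(** On the empty forest every cut gives the pair (1, 1). *)
Lemma one_along J (T : lforest d J) A : nnodes T = 0%N ->
  @cut_along d J T A (cp_one d J).
Proof.
case: T A => n l E h H LC /= A n0; subst n.
exists id, id; split; split.
- by split=> [[]|[]|[]|[]].
- by move=> j; apply/setP=> -[].
- by apply/setP=> k; rewrite inE; apply/esym/negP=> /restrHP[s [_ _ /set0Pn[[]]]].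
- by split=> [[]|[]|[]|[]].
- by move=> j; apply/setP=> -[].
- by move=> k s _ _; apply/setP=> -[].
by apply/setP=> k; rewrite inE; apply/esym/negP=> /restrHP[s [_ _ /set0Pn[[]]]].
Qed.

Lemma Delta_basisE J (T : Forest d J) :
  Delta_basis R T = \sum_(A | upset (edges (repr T)) A) basis R (cut_class A).
Proof.
rewrite /Delta_basis; case: eqP => [e|_]; last first.
  rewrite -(sum_forest_cuts (lions_forest (lforestP (repr T)))
    (fun A => basis R (cut_class A))).
  apply: eq_bigr => c cc; rewrite /cut_class cut_rootK //.
  exact: lions_forest (lforestP (repr T)).
have [f /iso_bij bf] : exists f, lf_iso eq (T := repr T) (T' := lf_empty d J) f.
  by apply: eqmod_iso; rewrite reprK.
have n0 : nnodes (repr T) = 0%N.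
  by have := bij_eq_card bf; rewrite !card_ord.
have up A : upset (edges (repr T)) A.
  by apply/upsetP=> x; have := ltn_ord x; rewrite [X in (_ < X)%N]n0.
rewrite (big_pred1 set0) => [|A].
  by rewrite /pair_one (cut_classE (up set0) (one_along set0 n0)).
rewrite up; apply/esym/eqP/setP=> x.
by have := ltn_ord x; rewrite [X in (_ < X)%N]n0.
Qed.

Lemma Delta_pi J (T : lforest d J) :
  Delta R d J (basis R (\pi_(Forest d J) T)) =
  \sum_(A | upset (edges T) A) basis R (cut_class A).
Proof.
rewrite /Delta /= linext_basis Delta_basisE; set T' := repr _.
have [f iso] : exists f, lf_iso eq (T := T') (T' := T) f by apply: eqmod_iso; rewrite reprK.
have [g fK gK] := iso_bij iso.
rewrite (reindex_onto (fun A : {set 'I_(nnodes T')} => f @: A)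
  (fun A : {set 'I_(nnodes T)} => g @: A)) /=; last first.
  by move=> A _; rewrite -imset_comp (eq_imset (g := id)) ?imset_id.
apply: eq_big => [A|A upA].
  rewrite (iso_upset _ iso) -imset_comp (eq_imset (g := id)) ?imset_id ?eqxx ?andbT //.
have up' : upset (edges T) (f @: A) by rewrite (iso_upset _ iso).
congr (basis R _).
by rewrite -(cut_classE up' (cut_along_isol iso (cut_class_along upA))) reprK.
Qed.

Lemma Delta_repr J (T : Forest d J) :
  Delta R d J (basis R T) =
  \sum_(A | upset (edges (repr T)) A) basis R (cut_class A).
Proof. by rewrite -{1}[T]reprK Delta_pi. Qed.

Lemma linext_sum (S : choiceType) (M : lmodType R) (f : S -> M) (X : Type)
    (r : seq X) P (q : X -> S) :
  linext f (\sum_(x <- r | P x) basis R (q x)) = \sum_(x <- r | P x) f (q x).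
Proof. by rewrite linear_sum; apply: eq_bigr => x _; apply: linext_basis. Qed.

Lemma linmap_sum (S S' : choiceType) (op : S -> S') (X : Type) (r : seq X) P
    (q : X -> S) :
  linmap op (\sum_(x <- r | P x) basis R (q x)) = \sum_(x <- r | P x) basis R (op (q x)).
Proof. exact: linext_sum. Qed.

Lemma Delta_rooting : compatible_rooting (Delta R d unit).
Proof.
move=> i T; rewrite /rooting Delta_pi [in RHS]Delta_repr linmap_sum.
set U := repr T; rewrite [LHS]sum_rooting_upsets; last exact: lions_forest (lforestP U).
congr (_ + _).
  congr (basis R _); apply/esym.
  have [f iso] : exists f,
      lf_iso eq (T := repr (\pi_(Forest d unit) (lf_rooting i U))) (T' := lf_rooting i U) f.
    by apply: eqmod_iso; rewrite reprK.
  apply: cut_classE; first by apply/upsetP=> x y; rewrite inE.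
  rewrite -(imset0 f); apply: cut_along_isol iso _.
  exact: with_one_along.
apply: eq_bigr => A upA; congr (basis R _); apply/esym.
apply: cut_classE; first by rewrite rooting_upset.
by apply: rooting_along => //; apply: cut_class_along.
Qed.

Lemma Delta_tag I : compatible_tag (Delta R d unit) (Delta R d I).
Proof.
move=> T iota; rewrite /tag_op Delta_pi Delta_repr linmap_sum.
apply: eq_bigr => A upA; congr (basis R _); apply/esym.
by apply: cut_classE => //; apply/tag_along/cut_class_along.
Qed.

Lemma Delta_prod I : compatible_prod (Delta R d I).
Proof.
move=> T T'; rewrite /forest_prod Delta_pi tensor_mapE !Delta_repr.
rewrite [LHS]sum_prod_upsets pair_big linext_sum.
under [X in linmap _ (linmap _ X)]eq_bigr => A _ do rewrite linext_sum.
rewrite pair_big !linmap_sum; apply: eq_bigr => -[A B] /= /andP[upA upB].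
congr (basis R _); apply/esym.
rewrite /prod_prod /twist /=.
have up : upset (edges (lf_prod (repr T) (repr T'))) (shift_union A B).
  by rewrite shift_union_upset upA.
apply: etrans (cut_classE up (prod_along (cut_class_along upA) (cut_class_along upB))).
by apply: cp_prod_equiv; rewrite reprK.
Qed.

End DeltaCuts.

(** * Generation of forests by tagged forests and products *)

Section Uniqueness.
Variable d : nat.

Lemma iso_pi_eq J (T T' : lforest d J) f : lf_iso eq (T := T) (T' := T') f ->
  \pi_(Forest d J) T = \pi_(Forest d J) T'.
Proof. by move=> iso; apply/eqmodP/asboolP; exists f. Qed.

Lemma restriction_exists J (T : lforest d J) (A : {set 'I_(nnodes T)}) :
  upset (edges T) A -> exists S f, @restricts d J S T A f.
Proof.
by move=> /cut_class_along[f [g [rf _]]]; exists (lower (repr (cut_class A))), f.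
Qed.

Lemma restricts_card J (S T : lforest d J) A f : @restricts d J S T A f ->
  nnodes S = #|A|.
Proof.
move=> [[fi im _ _] _ _]; rewrite -[LHS]card_ord -(card_imset _ fi).
apply: eq_card => y; apply/imsetP/idP => [[x _ ->]|/im[x ->]]; last by exists x.
by apply/im; exists x.
Qed.

(** A forest that splits along [A], so that no block meets both [A] and its
    complement, is the product of its two restrictions. *)
Lemma split_prod J (T S1 S2 : lforest d J) A f1 f2 :
    @restricts d J S1 T A f1 -> @restricts d J S2 T (~: A) f2 ->
    upset (edges T) A -> upset (edges T) (~: A) ->
    (forall s, s \in hyper T -> s \subset A \/ s \subset ~: A) ->
  exists f, lf_iso eq (T := lf_prod S1 S2) (T' := T) f.
Proof.
move=> [[i1 m1 l1 e1] t1 h1] [[i2 m2 l2 e2] t2 h2] /upsetP upA /upsetP upA' HA.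
pose f z := match split z with inl a => f1 a | inr b => f2 b end.
have fl a : f (lshift _ a) = f1 a by rewrite /f split_lshift.
have fr a : f (rshift _ a) = f2 a by rewrite /f split_rshift.
have f1A a : f1 a \in A by apply/m1; exists a.
have f2A a : f2 a \notin A by rewrite -in_setC; apply/m2; exists a.
have ne a b : f1 a <> f2 b by move=> e; move: (f1A a); rewrite e; apply/negP.
have fi : injective f.
  move=> x y; case: (split_ordP x) => a ->; case: (split_ordP y) => b ->;
  rewrite ?fl ?fr.
  - by move/i1->.
  - by move/ne.
  - by move/esym/ne.
  by move/i2->.
have fsurj y : exists x, f x = y.
  case: (boolP (y \in A)) => [/m1|]; last rewrite -in_setC => /m2.
    by case=> a ->; exists (lshift _ a); rewrite fl.
  by case=> a ->; exists (rshift _ a); rewrite fr.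
have im1 (s : {set _}) : f @: (@lshift _ (nnodes S2) @: (f1 @^-1: s)) = s :&: A.
  rewrite -imset_comp; apply/setP=> y; rewrite inE.
  apply/imsetP/andP => [[x xs ->]|[ys /m1[x ex]]].
    by rewrite /= fl f1A; move: xs; rewrite inE.
  by exists x; rewrite ?inE -?ex //= fl.
have im2 (s : {set _}) : f @: (@rshift (nnodes S1) _ @: (f2 @^-1: s)) = s :&: ~: A.
  rewrite -imset_comp; apply/setP=> y; rewrite in_setI.
  apply/imsetP/andP => [[x xs ->]|[ys /m2[x ex]]].
    by rewrite /= fr in_setC f2A; move: xs; rewrite inE.
  by exists x; rewrite ?inE -?ex //= fr.
exists f; split.
- have [g gE] := choice fsurj; exists g => x; last exact: gE.
  by apply: fi; rewrite gE.
- move=> x /=; case: (split_ordP x) => a ->; rewrite ?fl ?fr.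
    by rewrite ?split_lshift l1.
  by rewrite ?split_rshift l2.
- move=> x y /=; case: (split_ordP x) => a ->; case: (split_ordP y) => b ->;
  rewrite ?fl ?fr edge_shift //.
  + by apply/negP=> /(upA _ _ (f1A a)); apply/negP.
  apply/negP=> /upA'; rewrite !inE => /(_ (f2A a)); by rewrite f1A.
- move=> j _ <-; rewrite /= /prodh imsetU t1 t2 im1 im2.
  by apply/setP=> y; rewrite !inE; case: (y \in A); rewrite /= ?andbT ?andbF ?orbF.
apply/setP=> s; rewrite /= /prodH imsetU h1 h2; apply/idP/setUP.
  move=> sH; have s0 : s != set0 by apply: contraNneq (lions_set0 (lforestP T)) => <-.
  case: (HA s sH) => sA; [left|right].
    have es := im1 s; rewrite (setIidPl sA) in es.
    rewrite -{1}es; apply/imset_f/imset_f/restrHP; exists s; split=> //.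
    by apply: contraNneq s0 => e; rewrite -es e !imset0.
  have es := im2 s; rewrite (setIidPl sA) in es.
  rewrite -{1}es; apply/imset_f/imset_f/restrHP; exists s; split=> //.
  by apply: contraNneq s0 => e; rewrite -es e !imset0.
case=> /imsetP[_ /imsetP[_ /restrHP[t [tH -> t0]] ->] ->].
  rewrite im1; case: (HA t tH) => tA; first by rewrite (setIidPl tA).
  case/set0Pn: t0 => x; rewrite inE => /(subsetP tA).
  by rewrite inE f1A.
rewrite im2; case: (HA t tH) => tA; last by rewrite (setIidPl tA).
case/set0Pn: t0 => x; rewrite inE => /(subsetP tA) xA.
by move: (f2A x); rewrite xA.
Qed.

Lemma forest_prod_pi J (S1 S2 : lforest d J) :
  forest_prod (\pi_(Forest d J) S1) (\pi_(Forest d J) S2) = \pi_(Forest d J) (lf_prod S1 S2).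
Proof.
have [f1 i1] : exists f, lf_iso eq (T := repr (\pi_(Forest d J) S1)) (T' := S1) f.
  by apply: eqmod_iso; rewrite reprK.
have [f2 i2] : exists f, lf_iso eq (T := repr (\pi_(Forest d J) S2)) (T' := S2) f.
  by apply: eqmod_iso; rewrite reprK.
exact: iso_pi_eq (prod_iso i1 i2).
Qed.

Lemma one_tag_conditions (J : Type) (T : lforest d J) (j : J) :
    (forall k x, x \in tagged T k -> k = j) ->
  lions_conditions (edges T) (fun _ : unit => tagged T j) (hyper T).
Proof.
move=> tj; have LC := lforestP T.
have ne s : nonempty_hyperedge (fun _ : unit => tagged T j) (hyper T) s ->
    nonempty_hyperedge (tagged T) (hyper T) s.
  by case=> s0 [sH|[_ es]]; split=> //; [left|right; exists j].
apply: lions_conditions_intro.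
- exact: lions_forest LC.
- by move=> [] [].
- exact: lions_set0 LC.
- exact: lions_block_inj LC.
- move=> s [] x sH xs; exact: lions_block_tag LC _ _ _ sH xs.
- move=> x; case: (lions_cover LC x) => [[k xk]|]; last by right.
  by left; exists tt; rewrite -(tj _ _ xk).
- by move=> s /ne; apply: lions_climb LC _.
- by move=> s /ne; apply: lions_parents LC _.
by move=> _ x xj; apply: (lions_tag_root LC); apply/set0Pn; exists x.
Qed.

(** A forest whose only non-empty tagged hyperedge is that of [j] is in the image
    of [tag_op j]. *)
Lemma tag_op_surj J (T : lforest d J) (j : J) :
    (forall k x, x \in tagged T k -> k = j) ->
  exists T0, tag_op j T0 = \pi_(Forest d J) T.
Proof.
move=> tj; pose T0 := LForest (@label _ _ T) (one_tag_conditions tj).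
exists (\pi_(Forest d unit) T0).
have [f iso] : exists f, lf_iso eq (T := repr (\pi_(Forest d unit) T0)) (T' := T0) f.
  by apply: eqmod_iso; rewrite reprK.
apply: (@iso_pi_eq _ (lf_tag j (repr (\pi_(Forest d unit) T0))) T f).
case: iso => bf lf ef tf hf; split=> // k _ <-.
have e := tf tt tt erefl; rewrite /= in e; apply/setP=> x; apply/idP/imsetP.
  move=> xk; have ek := tj _ _ xk; subst k; move: xk; rewrite e => /imsetP[y ys ->].
  by exists y => //; rewrite inE; apply/asboolP; exists tt.
case=> y; rewrite inE => /asboolP[[] <- ys] ->.
by rewrite e; apply: imset_f.
Qed.

(** The nodes from which some node tagged by [j] can be reached; as tagged
    hyperedges contain a root, these are the component trees with root in
    [tagged T j]. *)
Definition tag_trees J (T : lforest d J) (j : J) : {set 'I_(nnodes T)} :=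
  [set x | [exists r in tagged T j, connect (edge (edges T)) x r]].

Lemma tag_trees_edge J (T : lforest d J) j x y : edge (edges T) x y ->
  (x \in tag_trees T j) = (y \in tag_trees T j).
Proof.
move=> xy; have LC := lforestP T; rewrite !inE; apply/exists_inP/exists_inP.
  case=> r rj /connectP[[|z p] /= pp er].
    exists y; last exact: connect0.
    by apply: lions_tag_up LC _ _ _ _ xy; rewrite -er.
  case/andP: pp => xz pp; exists r => //.
  by apply/connectP; exists p; rewrite // ((lions_forest LC).2 _ _ _ xy xz).
by case=> r rj yr; exists r => //; apply: connect_trans (connect1 xy) yr.
Qed.

Lemma tag_trees_tag J (T : lforest d J) j k x :
  x \in tagged T k -> (x \in tag_trees T j <-> k = j).
Proof.
move=> xk; split=> [|<-]; last by rewrite inE; apply/exists_inP; exists x.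
rewrite inE => /exists_inP[r rj]; have LC := lforestP T.
case/connectP=> p; elim: p x xk => [|a p IHp] x xk /=.
  by move=> _ er; apply: (lions_tag_inj LC xk); rewrite -er.
by case/andP=> xa; apply: IHp; apply: lions_tag_up LC _ _ _ xk xa.
Qed.

(** A block lies either in [tag_trees T j] or outside it. Two of its nodes can
    be taken at equal depth; as long as their parents differ the parents are
    also in the block, and a root in the block is not tagged. *)
Lemma tag_trees_block J (T : lforest d J) j s x y : s \in hyper T ->
  x \in s -> y \in s -> x \in tag_trees T j -> y \in tag_trees T j.
Proof.
move=> sH xs ys; have LC := lforestP T; have ns := nonempty_block LC sH.
have fE := lions_forest LC.
(* Replace the deeper node by its ancestor in the block at the other's depth. *)
wlog dxy : x y xs ys / depth (edges T) x = depth (edges T) y.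
  move=> WL xA; have up a b : connect (edge (edges T)) a b ->
      (a \in tag_trees T j) = (b \in tag_trees T j).
    case/connectP=> p; elim: p a => [|c p IHp] a /=; first by move=> _ ->.
    by case/andP=> ac pp eb; rewrite (tag_trees_edge j ac); apply: IHp.
  case: (leqP (depth (edges T) x) (depth (edges T) y)) => [le|/ltnW le].
    have [z [zs yz dz]] := lions_ancestor LC ns ys xs le.
    by rewrite (up _ _ yz); apply: (WL x z).
  have [z [zs xz dz]] := lions_ancestor LC ns xs ys le.
  by apply: (WL z y) => //; rewrite -(up _ _ xz).
have [n] := ubnP (depth (edges T) x).
elim: n x y xs ys dxy => // n IHn x y xs ys dxy lt_xn xA.
case: (boolP (is_root (edges T) x)) => [rx|/rootPn[x' xx']].
  move: xA; rewrite inE => /exists_inP[r rj xr].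
  by case: (lions_block_tag LC sH xs (j := j)); rewrite -(connect_root rx xr).
have [y' yy'] : exists y', edge (edges T) y y'.
  by apply: depth_gt0; rewrite -dxy (depth_edge fE xx').
have [e|ne] := eqVneq x' y'.
  by rewrite (tag_trees_edge j yy') -e -(tag_trees_edge j xx').
have [x's y's] := lions_parents LC ns xs ys dxy xx' yy' (elimN eqP ne).
rewrite (tag_trees_edge j yy'); apply: (IHn x' y') => //.
- by move: dxy; rewrite (depth_edge fE xx') (depth_edge fE yy') => -[].
- by move: lt_xn; rewrite (depth_edge fE xx') ltnS.
by rewrite -(tag_trees_edge j xx').
Qed.

(** The induction is on the number of nodes. A forest without tagged nodes is
    [tag_op j0] of the same forest with empty tagged hyperedge, for any [j0];
    this is where the index set has to be inhabited. *)
Lemma forest_ind (J : Type) (P : Forest d J -> Prop) : inhabited J ->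
    (forall T j, P (tag_op j T)) ->
    (forall T T', P T -> P T' -> P (forest_prod T T')) ->
  forall T, P T.
Proof.
move=> [j0] Ptag Pprod; elim/quotW=> T.
have [n] := ubnP (nnodes T); elim: n T => // n IHn T lt_Tn.
case: (pselect (exists j x, x \in tagged T j)) => [[j [x xj]]|nj]; last first.
  have [|T0 <-] := @tag_op_surj _ T j0; last exact: Ptag.
  by move=> k x xk; case: nj; exists k, x.
have xA : x \in tag_trees T j by apply/(tag_trees_tag j xj).
pose A := tag_trees T j.
have upA : upset (edges T) A by apply/upsetP=> a b aA ab; rewrite /A -(tag_trees_edge j ab).
have upA' : upset (edges T) (~: A).
  by apply/upsetP=> a b; rewrite !in_setC => aA ab; rewrite -(tag_trees_edge j ab).
have [AT|nAT] := eqVneq (~: A) set0.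
  have [|T0 <-] := @tag_op_surj _ T j; last exact: Ptag.
  move=> k y yk; apply/(tag_trees_tag j yk)/negPn; rewrite -/A -in_setC AT.
  by rewrite in_set0.
have [S1 [f1 r1]] := restriction_exists upA.
have [S2 [f2 r2]] := restriction_exists upA'.
have HA s : s \in hyper T -> s \subset A \/ s \subset ~: A.
  move=> sH; case: (boolP (s \subset A)) => sA; [by left|right].
  case/subsetPn: sA => a as_ aA; apply/subsetP=> b bs; rewrite in_setC.
  by apply: contra aA; apply: (tag_trees_block sH).
have [f iso] := split_prod r1 r2 upA upA' HA.
rewrite -(iso_pi_eq iso) -forest_prod_pi.
have cA : (#|A| + #|~: A| = nnodes T)%N by rewrite cardsC card_ord.
have A0 : (0 < #|A|)%N by apply/card_gt0P; exists x.
have A'0 : (0 < #|~: A|)%N by rewrite card_gt0.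
apply: Pprod; apply: IHn; rewrite ?(restricts_card r1) ?(restricts_card r2).
  by rewrite -ltnS; apply: leq_trans lt_Tn; rewrite ltnS -[X in (_ < X)%N]cA -addn1 leq_add2l.
by rewrite -ltnS; apply: leq_trans lt_Tn; rewrite ltnS -[X in (_ < X)%N]cA -add1n leq_add2r.
Qed.

End Uniqueness.

Theorem proposition4p26 (d : nat) (I : Type) (R : pzRingType) :
  [/\ compatible_rooting (Delta R d unit),
      compatible_tag (Delta R d unit) (Delta R d I),
      compatible_prod (Delta R d I) &
      inhabited I ->
      forall D : {linear fspan R (Forest d I) -> fspan R (CoupledPair d I)},
        compatible_rooting (Delta R d unit) ->
        compatible_tag (Delta R d unit) D ->
        compatible_prod D ->
        D =1 Delta R d I].
Proof.
split; [exact: Delta_rooting|exact: Delta_tag|exact: Delta_prod|].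
move=> inhI D _ Dtag Dprod; apply: linear_basis_ext.
apply: (forest_ind inhI) => [T j|T T' DT DT'].
  by rewrite Dtag Delta_tag.
by rewrite Dprod Delta_prod !tensor_mapE DT DT'.
Qed.
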